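(* Let $X\subset \mathbb R^n$ be open and let $F\subset J^2(X)$ be a constant-coefficient primitive subequation that depends only on the Hessian part. Suppose $f:X\times \mathbb R^m\to \mathbb R$ is locally semiconcave, bounded from below, and $F\#\mathcal P$-subharmonic on $X\times\mathbb R^m$. Then the marginal function $g(x) = \inf_{y\in\mathbb R^m} f(x,y)$ is $F$-subharmonic on $X$.
   Context: For open $X\subset\mathbb R^n$, the 2-jet bundle is $J^2(X)=X\times\mathbb R\times\mathbb R^n\times\operatorname{Sym}^2_n$, where $\operatorname{Sym}^2_n$ is the space of real symmetric $n\times n$ matrices; write $J^2_n=\mathbb R\times\mathbb R^n\times \operatorname{Sym}^2_n$, and for $F\subset J^2(X)$, $F_x=\{(r,p,A)\in J^2_n:(x,r,p,A)\in F\}$. $F$ is a primitive subequation if $F$ is closed and (positivity) $(r,p,A)\in F_x$ and $P$ positive semidefinite imply $(r,p,A+P)\in F_x$. $F$ is constant-coefficient if $F_x$ is independent of $x$; $F$ depends only on the Hessian part if for each $x$, $(r,p,A)\in F_x\iff(r',p',A)\in F_x$ for all $r,r',p,p',A$. For $f:X\to\mathbb R\cup\{-\infty\}$, a point $x$ with $f(x)\neq-\infty$ is an upper contact point with upper contact jet $(p,A)\in\mathbb R^n\times\operatorname{Sym}^2_n$ (also written $(f(x),p,A)$) if $f(y)\le f(x)+p\cdot(y-x)+\frac12(y-x)^tA(y-x)$ for all $y$ sufficiently near $x$. An upper-semicontinuous $f:X\to\mathbb R\cup\{-\infty\}$ is $F$-subharmonic if $(f(x),p,A)\in F_x$ for every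 upper contact jet $(p,A)$ of $f$ at every $x$. Let $\mathcal P\subset J^2(\mathbb R^m)$ be $\{(y,r,p,D): D \text{ positive semidefinite}\}$. For $\Gamma\in\operatorname{Hom}(\mathbb R^n,\mathbb R^m)$ (an $m\times n$ matrix) and $\alpha=(r,p,A)\in J^2_{n+m}$ with $p=(p_1,p_2)\in\mathbb R^n\times\mathbb R^m$ and $A=\begin{pmatrix}B&C\\C^t&D\end{pmatrix}$ in block form ($B\in\operatorname{Sym}^2_n$, $D\in\operatorname{Sym}^2_m$), set $i_\Gamma^*\alpha=(r,p_1+\Gamma^tp_2, B+C\Gamma+\Gamma^tC^t+\Gamma^tD\Gamma)\in J^2_n$ and $j^*\alpha=(r,p_2,D)\in J^2_m$. The product $F\#\mathcal P\subset J^2(X\times\mathbb R^m)$ is defined by $(F\#\mathcal P)_{(x,y)}=\{\alpha\in J^2_{n+m}: i_\Gamma^*\alpha\in F_x \text{ for all }\Gamma\in\operatorname{Hom}(\mathbb R^n,\mathbb R^m),\ j^*\alpha\in\mathcal P_y\}$. A function $h$ is $\kappa$-semiconcave ($\kappa\ge0$) if $h(z)-\frac\kappa2\|z\|^2$ is concave; locally semiconcave means every point has a neighbourhood on which $h$ is $\kappa$-semiconcave for some $\kappa\ge0$. *)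

(* Defs.v *)
From HB Require Import structures.
From mathcomp Require Import all_boot all_order all_algebra.
From mathcomp Require Import all_classical all_reals.
Set Implicit Arguments. Unset Strict Implicit. Unset Printing Implicit Defensive.
Import Order.TTheory GRing.Theory Num.Theory.
Local Open Scope ring_scope.
Local Open Scope classical_set_scope.

Section Defs.
Variable R : realType.

Definition sqnorm (k : nat) (v : 'cV[R]_k) : R := \sum_(i < k) (v i 0) ^+ 2.

(* Euclidean ball: |y - x| < r  (for r > 0) *)
Definition in_ball (k : nat) (x : 'cV[R]_k) (r : R) (y : 'cV[R]_k) : Prop :=
  sqnorm (y - x) < r ^+ 2.

Definition dotv (k : nat) (p v : 'cV[R]_k) : R := (p^T *m v) 0 0.
Definition qform (k : nat) (A : 'M[R]_k) (v : 'cV[R]_k) : R := (v^T *m A *m v) 0 0.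

Definition symmetric (k : nat) (A : 'M[R]_k) : Prop := A^T = A.
Definition psd (k : nat) (P : 'M[R]_k) : Prop :=
  symmetric P /\ forall v : 'cV[R]_k, 0 <= qform P v.

Definition open_set (k : nat) (X : set 'cV[R]_k) : Prop :=
  forall x, X x -> exists2 e : R, 0 < e & forall y, in_ball x e y -> X y.

(* A subset F of J^2(X), given fibrewise: F x r p A  means (x,r,p,A) \in F.
   Only x in X and symmetric A are meaningful. *)
Definition jetset (k : nat) := 'cV[R]_k -> R -> 'cV[R]_k -> 'M[R]_k -> Prop.

Definition jet_closed (k : nat) (X : set 'cV[R]_k) (F : jetset k) : Prop :=
  forall x r p A, X x -> symmetric A -> ~ F x r p A ->
  exists2 e : R, 0 < e &
    forall x' r' p' A', X x' -> symmetric A' ->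
      in_ball x e x' -> `|r' - r| < e -> in_ball p e p' ->
      (forall i j, `|A' i j - A i j| < e) -> ~ F x' r' p' A'.

Definition positivity (k : nat) (X : set 'cV[R]_k) (F : jetset k) : Prop :=
  forall x r p A P, X x -> symmetric A -> F x r p A -> psd P -> F x r p (A + P).

Definition primitive_subequation (k : nat) (X : set 'cV[R]_k) (F : jetset k) :=
  jet_closed X F /\ positivity X F.

Definition constant_coefficient (k : nat) (X : set 'cV[R]_k) (F : jetset k) :=
  forall x x' r p A, X x -> X x' -> symmetric A -> (F x r p A <-> F x' r p A).

Definition hessian_only (k : nat) (X : set 'cV[R]_k) (F : jetset k) :=
  forall x r r' p p' A, X x -> symmetric A -> (F x r p A <-> F x r' p' A).

Definition usc_on (k : nat) (X : set 'cV[R]_k) (f : 'cV[R]_k -> R) : Prop :=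
  forall x, X x -> forall eps : R, 0 < eps ->
    exists2 d : R, 0 < d & forall y, X y -> in_ball x d y -> f y < f x + eps.

Definition upper_contact (k : nat) (X : set 'cV[R]_k) (f : 'cV[R]_k -> R)
    (x p : 'cV[R]_k) (A : 'M[R]_k) : Prop :=
  symmetric A /\
  exists2 d : R, 0 < d & forall y, X y -> in_ball x d y ->
    f y <= f x + dotv p (y - x) + 2^-1 * qform A (y - x).

Definition F_subharmonic (k : nat) (X : set 'cV[R]_k) (F : jetset k)
    (f : 'cV[R]_k -> R) : Prop :=
  usc_on X f /\
  forall x p A, X x -> upper_contact X f x p A -> F x (f x) p A.

Definition prodP (n m : nat) (F : jetset n) : jetset (n + m) :=
  fun z r p A =>
    (forall G : 'M[R]_(m, n),
       F (usubmx z) r (usubmx p + G^T *m dsubmx p)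
         (ulsubmx A + ursubmx A *m G + G^T *m (ursubmx A)^T
            + G^T *m drsubmx A *m G))
    /\ psd (drsubmx A).

Definition prod_domain (n m : nat) (X : set 'cV[R]_n) : set 'cV[R]_(n + m) :=
  [set z | X (usubmx z)].

(* kappa-semiconcavity on a (convex) set U *)
Definition semiconcave_on (k : nat) (U : set 'cV[R]_k) (kappa : R)
    (h : 'cV[R]_k -> R) : Prop :=
  forall a b (t : R), U a -> U b -> 0 <= t <= 1 ->
    (1 - t) * (h a - kappa / 2 * sqnorm a) + t * (h b - kappa / 2 * sqnorm b)
    <= h ((1 - t) *: a + t *: b) - kappa / 2 * sqnorm ((1 - t) *: a + t *: b).

Definition locally_semiconcave (k : nat) (D : set 'cV[R]_k)
    (h : 'cV[R]_k -> R) : Prop :=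
  forall z, D z -> exists r : R, exists kappa : R,
    [/\ 0 < r, 0 <= kappa, (forall w, in_ball z r w -> D w) &
        semiconcave_on (in_ball z r) kappa h].

Definition bounded_below_on (k : nat) (D : set 'cV[R]_k) (h : 'cV[R]_k -> R) :=
  exists M : R, forall z, D z -> M <= h z.

Definition marginal (n m : nat) (f : 'cV[R]_(n + m) -> R) (x : 'cV[R]_n) : R :=
  inf [set f (col_mx x y) | y in [set: 'cV[R]_m]].

End Defs.

Arguments prod_domain {R n} m X _.
Arguments prodP {R n} m F _ _ _ _.

(* Main.v *)
Require Import Defs.
From mathcomp Require Import all_boot all_order all_algebra.
From mathcomp Require Import all_classical all_reals.
From mathcomp Require Import topology normedtype.
From mathcomp Require Import ring lra.
(** The contact points of the marginal [g] are transferred to contact points of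
    [f], using that [f] is convex in [y].  After adding [eps |y|^2] the infimum
    is attained, and one localises around a minimiser.  Sup-convolution in [x]
    makes [g] semiconvex (by a minimax argument, [f] being semiconcave in [x]
    and convex in [y]) and the minimiser [y(x)] Lipschitz; moreover
    [f(x,y) <= g(x) + K |y - y(x)|^2].  If on some ball of radius [r] the
    function [g] lies below a quadratic polynomial of Hessian [A], with equality
    at the centre up to [o(r^2)], and [y(x)] is [o(r)]-close to an affine map of
    slope [G], then [f] has a nearby upper contact jet whose pullback along [G]
    is almost [A].

    Such a ball is found without differentiating almost everywhere.  Among all
    contact Hessians [A] of [g], take one that almost minimises the largest
    eigenvalue plus a small multiple of the trace.  By Hopf's barrier argument
    [g] is then uniformly close to its contact paraboloid on a ball of definite
    relative size, because otherwise a better contact point would exist.  Inside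
    that ball, a Lipschitz map is close to an affine one on a smaller ball of
    definite relative size: pairs of points of nearly maximal slope squeeze the
    map between two cones. *)

Set Implicit Arguments. Unset Strict Implicit. Unset Printing Implicit Defensive.
Import Order.TTheory GRing.Theory Num.Theory.
Import numFieldNormedType.Exports.
Local Open Scope ring_scope.
Local Open Scope classical_set_scope.

(** * Euclidean geometry and compactness *)

Section Euclid.
Variable R : realType.
Implicit Types k n m : nat.

(** Subharmonicity of [f] speaks only at points carrying an upper contact jet of [f], and a test
    function for the marginal becomes one for [f] only if it also controls [y]. The control is a
    term N |y - y0 - G (x - x0)|^2: its pullback along [G] vanishes however large N is, which is why
    the minimisers must be nearly affine in [x]. Subtracting the given contact paraboloid reduces
    the task to finding a contact Hessian at most s; positivity then raises it to s, and closedness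
    lets s tend to 0. In the extremal problem the zero jet is a competitor, which keeps the largest
    eigenvalue of an almost minimiser below s, while semiconvexity bounds the trace from below. The
    trace is there for Hopf's barrier, whose Hessian has one very negative direction: its trace
    falls although its largest eigenvalue is positive. Sup-convolution and localisation displace the
    contact point. Constant coefficients, and independence of the value and gradient, make the
    displacement harmless. *)

Lemma dotvE k (u v : 'cV[R]_k) : dotv u v = \sum_i u i 0 * v i 0.
Proof. by rewrite /dotv mxE; apply: eq_bigr => i _; rewrite mxE. Qed.

Lemma dotvC k (u v : 'cV[R]_k) : dotv u v = dotv v u.
Proof. by rewrite !dotvE; apply: eq_bigr => i _; rewrite mulrC. Qed.

Lemma dotvDr k (u v w : 'cV[R]_k) : dotv u (v + w) = dotv u v + dotv u w.
Proof. by rewrite /dotv mulmxDr mxE. Qed.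

Lemma dotvZr k (u v : 'cV[R]_k) a : dotv u (a *: v) = a * dotv u v.
Proof. by rewrite /dotv -scalemxAr mxE. Qed.

Lemma dotvNr k (u v : 'cV[R]_k) : dotv u (- v) = - dotv u v.
Proof. by rewrite -scaleN1r dotvZr mulN1r. Qed.

Lemma dotv0r k (u : 'cV[R]_k) : dotv u 0 = 0.
Proof. by rewrite /dotv mulmx0 mxE. Qed.

Lemma dotvDl k (u v w : 'cV[R]_k) : dotv (v + w) u = dotv v u + dotv w u.
Proof. by rewrite dotvC dotvDr !(dotvC u). Qed.

Lemma dotvZl k (u v : 'cV[R]_k) a : dotv (a *: v) u = a * dotv v u.
Proof. by rewrite dotvC dotvZr (dotvC u). Qed.

Lemma dotvNl k (u v : 'cV[R]_k) : dotv (- v) u = - dotv v u.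
Proof. by rewrite dotvC dotvNr (dotvC u). Qed.

Lemma dotv0l k (u : 'cV[R]_k) : dotv 0 u = 0.
Proof. by rewrite dotvC dotv0r. Qed.

Definition dotvL := (dotvDl, dotvDr, dotvNl, dotvNr, dotvZl, dotvZr,
  dotv0l, dotv0r).

Lemma sqnormE k (v : 'cV[R]_k) : sqnorm v = dotv v v.
Proof. by rewrite dotvE; apply: eq_bigr => i _; rewrite expr2. Qed.

Lemma sqnorm_ge0 k (v : 'cV[R]_k) : 0 <= sqnorm v.
Proof. by apply: sumr_ge0 => i _; exact: sqr_ge0. Qed.

Lemma sqnorm0 k : sqnorm (0 : 'cV[R]_k) = 0.
Proof. by rewrite sqnormE dotv0r. Qed.

Lemma sqnormZ k a (v : 'cV[R]_k) : sqnorm (a *: v) = a ^+ 2 * sqnorm v.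
Proof. rewrite !sqnormE !dotvL; ring. Qed.

Lemma sqnormN k (v : 'cV[R]_k) : sqnorm (- v) = sqnorm v.
Proof. by rewrite !sqnormE !dotvL opprK. Qed.

Lemma sqnormD k (u v : 'cV[R]_k) :
  sqnorm (u + v) = sqnorm u + 2 * dotv u v + sqnorm v.
Proof. rewrite !sqnormE !dotvL (dotvC v u); ring. Qed.

Lemma sqnormB k (u v : 'cV[R]_k) :
  sqnorm (u - v) = sqnorm u - 2 * dotv u v + sqnorm v.
Proof. by rewrite sqnormD sqnormN dotvNr mulrN. Qed.

Lemma sqnorm_eq0 k (v : 'cV[R]_k) : (sqnorm v == 0) = (v == 0).
Proof.
apply/eqP/eqP => [|->]; last exact: sqnorm0.
move=> /eqP; rewrite psumr_eq0 => [/allP h|i _]; last exact: sqr_ge0.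
apply/colP => i; have := h i (mem_index_enum _).
by rewrite /= sqrf_eq0 mxE => /eqP.
Qed.

Lemma sqnorm_col_mx n m (u : 'cV[R]_n) (v : 'cV[R]_m) :
  sqnorm (col_mx u v) = sqnorm u + sqnorm v.
Proof.
rewrite /sqnorm big_split_ord /=; congr (_ + _); apply: eq_bigr => i _.
  by rewrite col_mxEu.
by rewrite col_mxEd.
Qed.

Lemma dotv_col_mx n m (u u' : 'cV[R]_n) (v v' : 'cV[R]_m) :
  dotv (col_mx u v) (col_mx u' v') = dotv u u' + dotv v v'.
Proof. by rewrite /dotv tr_col_mx mul_row_col mxE. Qed.

Lemma CauchySchwarz k (u v : 'cV[R]_k) :
  dotv u v ^+ 2 <= sqnorm u * sqnorm v.
Proof.
have [/eqP|u0] := eqVneq (sqnorm u) 0.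
  by rewrite sqnorm_eq0 => /eqP ->; rewrite dotv0l sqnorm0 mul0r expr0n.
have : 0 <= sqnorm (sqnorm u *: v - dotv u v *: u) by exact: sqnorm_ge0.
rewrite sqnormB !sqnormZ !dotvL (dotvC v u).
have -> : sqnorm u ^+ 2 * sqnorm v -
    2 * (sqnorm u * (dotv u v * dotv u v)) + dotv u v ^+ 2 * sqnorm u =
    sqnorm u * (sqnorm u * sqnorm v - dotv u v ^+ 2) by ring.
by rewrite pmulr_rge0 ?subr_ge0 // lt_def u0 sqnorm_ge0.
Qed.

Definition nrm k (v : 'cV[R]_k) : R := Num.sqrt (sqnorm v).

Lemma nrm_ge0 k (v : 'cV[R]_k) : 0 <= nrm v.
Proof. exact: sqrtr_ge0. Qed.
Hint Resolve nrm_ge0 : core.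

Lemma sqr_nrm k (v : 'cV[R]_k) : nrm v ^+ 2 = sqnorm v.
Proof. by rewrite sqr_sqrtr // sqnorm_ge0. Qed.

Lemma nrm0 k : nrm (0 : 'cV[R]_k) = 0.
Proof. by rewrite /nrm sqnorm0 sqrtr0. Qed.

Lemma nrm_eq0 k (v : 'cV[R]_k) : (nrm v == 0) = (v == 0).
Proof. by rewrite -sqnorm_eq0 -sqr_nrm sqrf_eq0. Qed.

Lemma nrmN k (v : 'cV[R]_k) : nrm (- v) = nrm v.
Proof. by rewrite /nrm sqnormN. Qed.

Lemma nrmBC k (u v : 'cV[R]_k) : nrm (u - v) = nrm (v - u).
Proof. by rewrite -nrmN opprB. Qed.

Lemma nrmZ k a (v : 'cV[R]_k) : nrm (a *: v) = `|a| * nrm v.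
Proof. by rewrite /nrm sqnormZ sqrtrM ?sqr_ge0 // sqrtr_sqr. Qed.

Lemma le_nrm k (v : 'cV[R]_k) r : 0 <= r -> (nrm v <= r) = (sqnorm v <= r ^+ 2).
Proof. by move=> r0; rewrite -sqr_nrm ler_sqr ?nnegrE. Qed.

Lemma lt_nrm k (v : 'cV[R]_k) r : 0 <= r -> (nrm v < r) = (sqnorm v < r ^+ 2).
Proof. by move=> r0; rewrite -sqr_nrm ltr_sqr ?nnegrE. Qed.

Lemma normr_dotv k (u v : 'cV[R]_k) : `|dotv u v| <= nrm u * nrm v.
Proof.
rewrite -ler_sqr ?nnegrE ?mulr_ge0 // exprMn !sqr_nrm real_normK ?num_real //.
exact: CauchySchwarz.
Qed.

Lemma dotv_le k (u v : 'cV[R]_k) : dotv u v <= nrm u * nrm v.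
Proof. exact: le_trans (ler_norm _) (normr_dotv _ _). Qed.

Lemma nrmD k (u v : 'cV[R]_k) : nrm (u + v) <= nrm u + nrm v.
Proof.
rewrite le_nrm ?addr_ge0 // sqnormD -!sqr_nrm.
have := dotv_le u v; nra.
Qed.

Lemma nrmB k (u v : 'cV[R]_k) : nrm (u - v) <= nrm u + nrm v.
Proof. by rewrite -[X in _ <= _ + X]nrmN nrmD. Qed.

Lemma nrm_coord k (v : 'cV[R]_k) i : `|v i 0| <= nrm v.
Proof.
rewrite -ler_sqr ?nnegrE // sqr_nrm real_normK ?num_real //.
by rewrite /sqnorm (bigD1 i) //= lerDl sumr_ge0 // => j _; exact: sqr_ge0.
Qed.

Lemma nrm_col_mxl n m (u : 'cV[R]_n) (v : 'cV[R]_m) : nrm u <= nrm (col_mx u v).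
Proof. by rewrite le_nrm // sqr_nrm sqnorm_col_mx lerDl sqnorm_ge0. Qed.

Lemma nrm_col_mxr n m (u : 'cV[R]_n) (v : 'cV[R]_m) : nrm v <= nrm (col_mx u v).
Proof. by rewrite le_nrm // sqr_nrm sqnorm_col_mx lerDr sqnorm_ge0. Qed.

Lemma nrm_col_mx n m (u : 'cV[R]_n) (v : 'cV[R]_m) :
  nrm (col_mx u v) <= nrm u + nrm v.
Proof.
rewrite le_nrm ?addr_ge0 // sqnorm_col_mx -!sqr_nrm.
have := nrm_ge0 u; have := nrm_ge0 v; nra.
Qed.

Lemma in_ballE k (x y : 'cV[R]_k) r : 0 < r -> in_ball x r y <-> nrm (y - x) < r.
Proof. by move=> /ltW r0; rewrite /in_ball lt_nrm. Qed.

Lemma sqnorm_conv k t (a b : 'cV[R]_k) :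
  sqnorm ((1 - t) *: a + t *: b) =
  (1 - t) * sqnorm a + t * sqnorm b - t * (1 - t) * sqnorm (a - b).
Proof. rewrite sqnormB sqnormD !sqnormZ !dotvL; ring. Qed.

Lemma conv_in_ball k t (a b c : 'cV[R]_k) r : 0 <= t <= 1 ->
  nrm (a - c) <= r -> nrm (b - c) <= r ->
  nrm ((1 - t) *: a + t *: b - c) <= r.
Proof.
move=> /andP[t0 t1] ha hb.
have -> : (1 - t) *: a + t *: b - c = (1 - t) *: (a - c) + t *: (b - c).
  by apply/colP => i; rewrite !mxE; ring.
apply: le_trans (nrmD _ _) _; rewrite !nrmZ !ger0_norm ?subr_ge0 //.
have := nrm_ge0 (a - c); have := nrm_ge0 (b - c); nra.
Qed.

Lemma qformE k (A : 'M[R]_k) v : qform A v = dotv v (A *m v).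
Proof. by rewrite /qform /dotv mulmxA. Qed.

Lemma qformDl k (A B : 'M[R]_k) v : qform (A + B) v = qform A v + qform B v.
Proof. by rewrite !qformE mulmxDl dotvDr. Qed.

Lemma qformNl k (A : 'M[R]_k) v : qform (- A) v = - qform A v.
Proof. by rewrite !qformE mulNmx dotvNr. Qed.

Lemma qform_scal k a (v : 'cV[R]_k) : qform a%:M v = a * sqnorm v.
Proof. by rewrite qformE mul_scalar_mx dotvZr sqnormE. Qed.

Lemma qformZ k (A : 'M[R]_k) a v : qform A (a *: v) = a ^+ 2 * qform A v.
Proof. rewrite !qformE -scalemxAr !dotvL; ring. Qed.

Lemma qformN k (A : 'M[R]_k) v : qform A (- v) = qform A v.
Proof. by rewrite -scaleN1r qformZ sqrrN expr1n mul1r. Qed.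

Lemma qform0 k (A : 'M[R]_k) : qform A 0 = 0.
Proof. by rewrite qformE mulmx0 dotv0r. Qed.

Lemma qformD k (A : 'M[R]_k) u v : Defs.symmetric A ->
  qform A (u + v) = qform A u + 2 * dotv (A *m u) v + qform A v.
Proof.
move=> sA; rewrite !qformE mulmxDr !dotvL (dotvC v).
have -> : dotv u (A *m v) = dotv (A *m u) v.
  by rewrite /dotv trmx_mul sA mulmxA.
ring.
Qed.

Lemma qform_dyad k (d v : 'cV[R]_k) : qform (d *m d^T) v = dotv d v ^+ 2.
Proof.
by rewrite /qform !mulmxA -mulmxA mxE big_ord1 -/(dotv v d) -/(dotv d v) dotvC expr2.
Qed.

Lemma qform_delta k (A : 'M[R]_k) i : qform A (delta_mx i 0) = A i i.
Proof.
rewrite qformE -colE /dotv mxE (bigD1 i) //= big1 => [|j ji]; last first.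
  by rewrite !mxE (negPf ji) mul0r.
by rewrite !mxE !eqxx mul1r addr0.
Qed.

Lemma sqnorm_delta k (i : 'I_k) : sqnorm (delta_mx i 0 : 'cV[R]_k) = 1.
Proof.
rewrite /sqnorm (bigD1 i) //= big1 => [|j ji]; last first.
  by rewrite !mxE (negPf ji) expr0n.
by rewrite !mxE !eqxx expr1n addr0.
Qed.

(** Bounded coordinates place the sequence in a compact cube; a sup-norm ball of radius e / (k + 1)
    lies inside the Euclidean ball of radius e. *)
Lemma ball_cluster k (x : nat -> 'cV[R]_k) M :
  (forall j, nrm (x j) <= M) ->
  exists v, forall e : R, 0 < e -> forall N, exists2 j, (N <= j)%N & nrm (x j - v) < e.
Proof.
move=> xM.
have cM : compact [set v : 'rV[R]_k | forall i, `[- M, M]%classic (v ord0 i)].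
  apply: (@rV_compact _ _ (fun=> `[- M, M]%classic)) => _.
  exact: segment_compact.
have [] := cM ((fun j => (x j)^T) @ \oo) _.
  exists 0%N => // j _ /= i; rewrite mxE in_itv /= -ler_norml.
  exact: le_trans (nrm_coord _ _) (xM j).
move=> v [_ clv]; exists v^T => e e0 N.
have e1 : 0 < e / (k%:R + 1) by rewrite divr_gt0 // ltr_wpDl.
have [] := clv [set w | exists2 j, (N <= j)%N & w = (x j)^T]
    (ball v (e / (k%:R + 1))) _ _.
- by exists N => // j Nj /=; exists j.
- exact: nbhsx_ballx.
move=> _ [[j Nj ->]] vj; exists j => //.
rewrite lt_nrm ?(ltW e0) //.
have h i : `|(x j - v^T) i 0| < e / (k%:R + 1).
  by case: vj => _ /(_ 0 i); rewrite /ball /= !mxE distrC.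
apply: (@le_lt_trans _ _ (\sum_(i < k) (e / (k%:R + 1)) ^+ 2)).
  apply: ler_sum => i _; rewrite -real_normK ?num_real //.
  by rewrite ler_sqr ?nnegrE ?(ltW e1) // ltW.
rewrite sumr_const card_ord -[X in X < _]mulr_natl exprMn exprVn mulrCA.
rewrite -[X in _ < X]mulr1 ltr_pM2l ?exprn_gt0 // ltr_pdivrMr ?mul1r.
  by have : 0 <= k%:R :> R by []; nra.
by rewrite exprn_gt0 // ltr_wpDl.
Qed.

Definition closed_pts k (C : set 'cV[R]_k) :=
  forall v, (forall e : R, 0 < e -> exists2 w, C w & nrm (w - v) < e) -> C v.

Definition usc_at k (C : set 'cV[R]_k) (f : 'cV[R]_k -> R) v :=
  forall e : R, 0 < e ->
    exists2 d : R, 0 < d & forall w, C w -> nrm (w - v) < d -> f w < f v + e.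

Lemma nat_inv_lt (e : R) : 0 < e ->
  exists N, forall j, (N <= j)%N -> (j.+1)%:R^-1 < e.
Proof.
move=> e0; exists (Num.bound e^-1) => j Nj.
rewrite invf_plt ?posrE //.
apply: lt_le_trans (archi_boundP _) _; first by rewrite invr_ge0 ltW.
by rewrite ler_nat ltnW.
Qed.

(** The same cluster argument serves twice: along a sequence with [f] unbounded it yields an upper
    bound, along a maximising sequence it yields the maximiser. *)
Lemma usc_max k (C : set 'cV[R]_k) (f : 'cV[R]_k -> R) M :
  C !=set0 -> (forall v, C v -> nrm v <= M) -> closed_pts C ->
  (forall v, C v -> usc_at C f v) ->
  exists2 v, C v & forall w, C w -> f w <= f v.
Proof.
move=> [v0 Cv0] CM cC uf.
have cluster (x : nat -> 'cV[R]_k) : (forall j, C (x j)) ->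
    exists2 v, C v & forall e : R, 0 < e -> forall N, exists2 j, (N <= j)%N &
      f (x j) < f v + e.
  move=> Cx; have [v cv] := ball_cluster (fun j => CM _ (Cx j)).
  have Cv : C v by apply: cC => e /cv/(_ 0%N)[j _ ?]; exists (x j).
  exists v => // e e0 N; have [d d0 fd] := uf v Cv e e0.
  by have [j Nj jd] := cv d d0 N; exists j => //; exact: fd.
have [B fB] : exists B, forall v, C v -> f v <= B.
  apply: contrapT => nB.
  have /choice[x xP] N : exists x, C x /\ N%:R < f x.
    apply: contrapT => nx; apply: nB; exists N%:R => v Cv.
    by rewrite leNgt; apply/negP => fv; apply: nx; exists v.
  have [v Cv cv] := cluster x (fun j => (xP j).1).
  have [j Nj] := cv 1 ltr01 (Num.bound (`|f v| + 1)).
  apply/negP; rewrite -leNgt; apply: le_trans (ltW (xP j).2).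
  apply: (@le_trans _ _ (`|f v| + 1)); first by rewrite lerD2r ler_norm.
  apply: le_trans (ltW (archi_boundP _)) _; first by rewrite addr_ge0.
  by rewrite ler_nat.
have hs : has_sup (f @` C).
  by split; [exists (f v0); exists v0|exists B => _ [v Cv <-]; exact: fB].
have /choice[x xP] N : exists x, C x /\ sup (f @` C) - N.+1%:R^-1 < f x.
  have N0 : 0 < N.+1%:R^-1 :> R by rewrite invr_gt0.
  by have [_ [x Cx <-] ?] := sup_adherent N0 hs; exists x.
have [v Cv cv] := cluster x (fun j => (xP j).1).
exists v => // w Cw.
have fw : f w <= sup (f @` C) by apply: ub_le_sup; [exact: hs.2|exists w].
apply: le_trans fw _; apply/ler_addgt0Pr => e e0.
have e2 : 0 < e / 2 by rewrite divr_gt0.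
have [N NP] := nat_inv_lt e2; have [j Nj] := cv _ e2 N.
have := (xP j).2; have := NP j Nj; move: _^-1 (sup _) => i S; lra.
Qed.

End Euclid.

#[global] Hint Resolve nrm_ge0 sqnorm_ge0 : core.

(** * Quantitative differentiation of Lipschitz maps *)

Section QuantitativeDifferentiation.
Variable R : realType.
Implicit Types n m : nat.

Definition lip_on n (y : 'cV[R]_n -> R) (L : R) x0 (r0 : R) :=
  forall u v, nrm (u - x0) <= r0 -> nrm (v - x0) <= r0 ->
    `|y u - y v| <= L * nrm (u - v).

Definition affine_on n (y : 'cV[R]_n -> R) (th : R) c (r : R) :=
  exists e : 'cV[R]_n, forall x, nrm (x - c) <= r ->
    `|y x - y c - dotv e (x - c)| <= th * r.

(** From (s - |w + v|)^2 >= 0: a cone seen at distance s from its apex is affine up to an error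
    quadratic in v. *)
Lemma amgm_nrm n (w v : 'cV[R]_n) s : 0 < s -> s ^+ 2 = sqnorm w ->
  nrm (w + v) <= s + dotv w v / s + sqnorm v / (2 * s).
Proof.
move=> s0 sw.
have -> : s + dotv w v / s + sqnorm v / (2 * s) =
    (s ^+ 2 + nrm (w + v) ^+ 2) / (2 * s).
  rewrite sqr_nrm sqnormD -sw; field; lra.
rewrite ler_pdivlMr; last lra.
have := sqr_ge0 (s - nrm (w + v)); nra.
Qed.

(* Two cones with nearly the slope of the secant through [c - w] and [c + w]
   squeeze [y] near the midpoint [c]. *)
Lemma affine_of_cones n (y : 'cV[R]_n -> R) rho eta sg L c w :
  0 < rho -> 0 <= eta -> 0 <= sg <= L -> 0 < nrm w ->
  2 * nrm w * sg <= y (c + w) - y (c - w) ->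
  (forall v, nrm v <= rho * nrm w ->
    y (c + v) <= y (c - w) + (sg + eta) * nrm (w + v) /\
    y (c + w) - (sg + eta) * nrm (w - v) <= y (c + v)) ->
  affine_on y (2 * eta / rho + (L + eta) * rho / 2) c (rho * nrm w).
Proof.
move=> rho0 eta0 /andP[sg0 sgL]; set s := nrm w => s0 ysg H.
have sqw : s ^+ 2 = sqnorm w by exact: sqr_nrm.
exists (((sg + eta) / s) *: w) => x; set v := x - c => vr.
have xE : x = c + v by rewrite addrC subrK.
have [h1 h2] := H v vr.
have [h3 h4] : y c <= y (c - w) + (sg + eta) * s /\
       y (c + w) - (sg + eta) * s <= y c.
  by have := H 0; rewrite nrm0 subr0 !addr0; apply; rewrite mulr_ge0 // ltW.
have k1 := amgm_nrm v s0 sqw.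
have := amgm_nrm (- v) s0 sqw; rewrite sqnormN dotvNr => k2.
rewrite xE dotvZl.
have -> : (sg + eta) / s * dotv w v = (sg + eta) * (dotv w v / s) by ring.
have k3 : sqnorm v / (2 * s) <= rho ^+ 2 * s / 2.
  rewrite ler_pdivrMr; last lra.
  rewrite -sqr_nrm; have := nrm_ge0 v; nra.
(* The first term is the mismatch of the two cones at the centre, the second the quadratic error of
   [amgm_nrm]. *)
have -> : (2 * eta / rho + (L + eta) * rho / 2) * (rho * s) =
       2 * s * eta + (L + eta) * (rho ^+ 2 * s / 2) by field; lra.
rewrite mulNr in k2.
have rs : 0 <= rho ^+ 2 * s / 2 by nra.
move: (dotv w v / s) (sqnorm v / (2 * s)) (rho ^+ 2 * s / 2) k1 k2 k3 rs
  => d q q' k1 k2 k3 rs.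
have se : 0 <= sg + eta by lra.
have m1 := ler_wpM2l se k1; have m2 := ler_wpM2l se k2.
have m3 := ler_wpM2l se k3.
have m4 : (sg + eta) * q' <= (L + eta) * q' by rewrite ler_wpM2r // lerD2r.
rewrite ler_norml; apply/andP; split; lra.
Qed.

Definition between_cones n (y : 'cV[R]_n -> R) rho sg c (w : 'cV[R]_n) :=
  forall v, nrm v <= rho * nrm w ->
    y (c + v) <= y (c - w) + sg * nrm (w + v) /\
    y (c + w) - sg * nrm (w - v) <= y (c + v).

(** A cone bound failing at c + v exhibits a secant of slope above [sg], from c - w to c + v or from
    c + v to c + w. The factors 1/4 and 3/4 come from |v| <= |w| / 2. *)
Lemma steeper_pair n (y : 'cV[R]_n -> R) rho sg c w :
  0 < rho <= 2^-1 -> 0 < nrm w -> ~ between_cones y rho sg c w ->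
  exists c' w', [/\ nrm (c' - c) <= 3 / 4 * nrm w, nrm w / 4 <= nrm w',
    nrm w' <= 3 / 4 * nrm w & 2 * nrm w' * sg < y (c' + w') - y (c' - w')].
Proof.
move=> /andP[rho0 rho1] w0 nH; apply: contrapT => nex; apply: nH => v vr.
have vs : nrm v <= nrm w / 2 by nra.
have hw : `|2^-1 : R| = 2^-1 by rewrite ger0_norm ?invr_ge0.
have t1 := nrmD w v.
have t2 := nrmB w v.
have t3 := nrmB (w + v) v; rewrite addrK in t3.
have t4 := nrmD (w - v) v; rewrite subrK in t4.
split; rewrite leNgt; apply/negP => hlt; apply: nex.
- exists (c + 2^-1 *: (v - w)), (2^-1 *: (w + v)).
  rewrite addrC addKr !nrmZ hw nrmBC; split; [lra|lra|lra|].
  have -> : c + 2^-1 *: (v - w) + 2^-1 *: (w + v) = c + v.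
    by apply/colP => i; rewrite !mxE; field.
  have -> : c + 2^-1 *: (v - w) - 2^-1 *: (w + v) = c - w.
    by apply/colP => i; rewrite !mxE; field.
  lra.
- exists (c + 2^-1 *: (w + v)), (2^-1 *: (w - v)).
  rewrite addrC addKr !nrmZ hw; split; [lra|lra|lra|].
  have -> : c + 2^-1 *: (w + v) + 2^-1 *: (w - v) = c + w.
    by apply/colP => i; rewrite !mxE; field.
  have -> : c + 2^-1 *: (w + v) - 2^-1 *: (w - v) = c + v.
    by apply/colP => i; rewrite !mxE; field.
  lra.
Qed.

Lemma slope_le n (y : 'cV[R]_n -> R) L x0 r0 c w sg : lip_on y L x0 r0 ->
  nrm (c - x0) + nrm w <= r0 -> 0 < nrm w ->
  2 * nrm w * sg <= y (c + w) - y (c - w) -> sg <= L.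
Proof.
move=> yL cw w0 ysg; have := yL (c + w) (c - w).
have -> : c + w - x0 = (c - x0) + w by rewrite addrAC.
have -> : c - w - x0 = (c - x0) - w by rewrite addrAC.
move=> /(_ (le_trans (nrmD _ _) cw) (le_trans (nrmB _ _) cw)).
have -> : c + w - (c - w) = 2 *: w by apply/colP => i; rewrite !mxE; ring.
rewrite nrmZ [`|2|]ger0_norm // => h5.
have := ler_norm (y (c + w) - y (c - w)); nra.
Qed.

(* Slopes are at most [L], so [steeper_pair] can only be iterated boundedly
   often. *)
Lemma lip_affine_iter n (y : 'cV[R]_n -> R) L x0 r0 rho eta :
  lip_on y L x0 r0 -> 0 < rho <= 2^-1 -> 0 < eta ->
  forall N c w sg, 0 <= sg -> 0 < nrm w -> nrm (c - x0) + 3 * nrm w <= r0 ->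
    L - N%:R * eta <= sg -> 2 * nrm w * sg <= y (c + w) - y (c - w) ->
  exists c' r, [/\ nrm w * rho * 4^-1 ^+ N <= r, nrm (c' - x0) + r <= r0 &
    affine_on y (2 * eta / rho + (L + eta) * rho / 2) c' r].
Proof.
move=> yL rho1 eta0 N; have /andP[rho0 rho2] := rho1.
elim: N => [|N IH] c w sg sg0 w0 cw Lsg ysg.
all: have sgL : sg <= L by apply: (slope_le yL _ w0 ysg); lra.
all: have [H|/(steeper_pair rho1 w0)[c' [w' [cc' ww1 ww2 yw]]]] :=
  pselect (between_cones y rho (sg + eta) c w).
1,3: exists c, (rho * nrm w); split; [|nra|].
- by rewrite expr0 mulr1 mulrC.
- by apply: (affine_of_cones _ _ _ _ ysg H) => //; [exact: ltW|rewrite sg0].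
- rewrite (mulrC rho); apply: ler_piMr; first by rewrite mulr_ge0 // ltW.
  by apply: exprn_ile1; rewrite ?invr_ge0 // invf_le1 ?ler1n.
- by apply: (affine_of_cones _ _ _ _ ysg H) => //; [exact: ltW|rewrite sg0].
all: have w'0 : 0 < nrm w' by lra.
all: have cx : nrm (c' - x0) <= nrm (c' - c) + nrm (c - x0)
  by rewrite -(subrKA c) nrmD.
  have : sg + eta <= L by apply: (slope_le yL _ w'0 (ltW yw)); lra.
  lra.
(* The invariant on |c - x0| + 3 |w| survives: the centre moves by at most 3/4 |w|, while 3 |w|
   drops by at least as much. *)
have [|||c'' [r [hr h1 h2]]] := IH c' w' (sg + eta) _ w'0 _ _ (ltW yw).
- lra.
- lra.
- by move: Lsg; rewrite -natr1; lra.
exists c'', r; split => //; apply: le_trans hr.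
rewrite exprS mulrA ler_wpM2r ?exprn_ge0 ?invr_ge0 //; nra.
Qed.

Lemma lip_affine n L th : 0 <= L -> 0 < th ->
  exists2 rho0 : R, 0 < rho0 <= 1 & forall (y : 'cV[R]_n -> R) x0 r0,
    0 < r0 -> lip_on y L x0 r0 ->
    exists c r, [/\ rho0 * r0 <= r, nrm (c - x0) + r <= r0 & affine_on y th c r].
Proof.
move=> L0 th0; case: n => [|n].
  exists 1 => [|y x0 r0 r00 yL]; first by rewrite ltr01 lexx.
  exists x0, r0; rewrite mul1r subrr nrm0 add0r; split => //.
  exists 0 => x _; rewrite dotv0l (_ : x = x0) ?subrr ?subr0 ?normr0.
    by rewrite mulr_ge0 // ltW.
  by apply/colP; case.
(* [rho] makes the curvature error of the cones, and then [eta] their mismatch, at most th / 2. [N]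
   steps of size [eta] exhaust the slopes from 0 to [L]. *)
set rho := th / (th * 2 + 2 * (L + 1)).
have den : 0 < th * 2 + 2 * (L + 1) by lra.
have rho0 : 0 < rho by rewrite divr_gt0.
have rho1 : rho <= 2^-1 by rewrite ler_pdivrMr //; lra.
have rhoL : rho * (L + 1) <= th / 2.
  rewrite /rho mulrAC ler_pdivrMr //; nra.
pose eta := Num.min 1 (th * rho / 4).
have eta0 : 0 < eta by rewrite /eta lt_min ltr01 /= divr_gt0 // mulr_gt0.
have eta1 : eta <= 1 by rewrite ge_min lexx.
have etath : 2 * eta / rho <= th / 2.
  have : eta <= th * rho / 4 by rewrite ge_min lexx orbT.
  rewrite ler_pdivrMr //; lra.
pose N := Num.bound (L / eta).
have NL : L - N%:R * eta <= 0.
  have := archi_boundP (divr_ge0 L0 (ltW eta0)); rewrite ltr_pdivrMr // -/N; lra.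
have q0 : 0 < 4^-1 ^+ N :> R by rewrite exprn_gt0 // invr_gt0.
have q1 : 4^-1 ^+ N <= 1 :> R by apply: exprn_ile1; rewrite ?invr_ge0 // invf_le1 ?ler1n.
exists (3^-1 * rho * 4^-1 ^+ N) => [|y x0 r0 r00 yL].
  apply/andP; split; [by rewrite !mulr_gt0 // invr_gt0|nra].
have e1 : nrm (delta_mx ord0 0 : 'cV[R]_n.+1) = 1.
  by rewrite /nrm sqnorm_delta sqrtr1.
(* Replacing [y] by its opposite, the initial secant has slope at least 0. Its half-length r0 / 3
   meets the invariant with equality. *)
wlog y0 : y yL / y (x0 - (r0 / 3) *: delta_mx ord0 0) <=
                 y (x0 + (r0 / 3) *: delta_mx ord0 0).
  move=> H; have [h|h] := leP (y (x0 - (r0 / 3) *: delta_mx ord0 0))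
                              (y (x0 + (r0 / 3) *: delta_mx ord0 0)).
    exact: H.
  have [||c [r [h1 h2 [e eP]]]] := H (fun x => - y x).
  - by move=> u v hu hv; rewrite -opprD normrN; exact: yL.
  - by rewrite lerN2 ltW.
  exists c, r; split => //; exists (- e) => x hx; have := eP x hx.
  by rewrite dotvNl -!opprD normrN opprK.
have [|||||c [r [h1 h2 h3]]] := lip_affine_iter yL (rho := rho) (eta := eta) _
  eta0 (N := N) (c := x0) (w := (r0 / 3) *: delta_mx ord0 0) (sg := 0) (lexx 0).
- by rewrite rho0.
- by rewrite nrmZ e1 mulr1 normr_gt0; lra.
- rewrite subrr nrm0 add0r nrmZ e1 mulr1 ger0_norm; lra.
- exact: NL.
- by rewrite mulr0 subr_ge0.
exists c, r; split => //.
  apply: le_trans h1; rewrite nrmZ e1 mulr1 ger0_norm; last lra.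
  by rewrite le_eqVlt; apply/orP; left; apply/eqP; ring.
case: h3 => e eP; exists e => x hx; apply: le_trans (eP x hx) _.
rewrite ler_wpM2r //; last nra.
by apply: le_trans (nrm_ge0 _) hx.
Qed.

(* Components are treated one after the other; the previous ones are affine
   at a scale so much finer that passing to a subball is harmless. *)
Lemma lip_family_affine n L th k : 0 <= L -> 0 < th ->
  exists2 rho0 : R, 0 < rho0 <= 1 &
    forall (y : nat -> 'cV[R]_n -> R) x0 r0, 0 < r0 ->
    (forall i, (i < k)%N -> lip_on (y i) L x0 r0) ->
    exists c r, [/\ rho0 * r0 <= r, nrm (c - x0) + r <= r0 &
      forall i, (i < k)%N -> affine_on (y i) th c r].
Proof.
move=> L0; elim: k th => [|k IH] th th0.
  exists 1 => [|y x0 r0 r00 _]; first by rewrite ltr01 lexx.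
  by exists x0, r0; rewrite mul1r subrr nrm0 add0r; split.
have [rho1 /andP[rho10 rho11] H1] := lip_affine n L0 th0.
(* Recentring an affine approximation costs two errors at the old scale [r], and the new radius is
   at least rho1 r. *)
have th'0 : 0 < th * rho1 / 2 by rewrite divr_gt0 // mulr_gt0.
have [rho2 /andP[rho20 rho21] H2] := IH _ th'0.
exists (rho1 * rho2) => [|y x0 r0 r00 yL].
  by rewrite mulr_gt0 //= mulr_ile1 // ltW.
have [|c [r [h1 h2 h3]]] := H2 y x0 r0 r00.
  by move=> i ik; apply: yL; rewrite ltnS ltnW.
have r_gt0 : 0 < r by apply: lt_le_trans h1; rewrite mulr_gt0.
have sub u : nrm (u - c) <= r -> nrm (u - x0) <= r0.
  by move=> hu; rewrite -(subrKA c); apply: le_trans (nrmD _ _) _; lra.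
have [|c' [r' [h1' h2' h3']]] := H1 (y k) c r r_gt0.
  by move=> u v /sub hu /sub hv; exact: yL.
exists c', r'; split.
- by rewrite -mulrA; apply: le_trans h1'; rewrite ler_wpM2l // ltW.
- have := nrmD (c' - c) (c - x0); rewrite subrKA; lra.
move=> i; rewrite ltnS leq_eqVlt => /orP[/eqP -> //|ik].
have [e eP] := h3 i ik; exists e => x hx.
have c'r : nrm (c' - c) <= r by have : 0 <= r' by [exact: le_trans (nrm_ge0 _) hx]; lra.
have xr : nrm (x - c) <= r.
  by have := nrmD (x - c') (c' - c); rewrite subrKA; lra.
have k1 := eP x xr; have k2 := eP c' c'r.
have -> : y i x - y i c' - dotv e (x - c') =
  (y i x - y i c - dotv e (x - c)) - (y i c' - y i c - dotv e (c' - c)).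
  by rewrite !dotvL; ring.
apply: le_trans (ler_normB _ _) _.
have : th * (rho1 * r) <= th * r' by rewrite ler_wpM2l // ltW.
lra.
Qed.

Lemma lip_map_affine n m L th : 0 <= L -> 0 < th ->
  exists2 rho0 : R, 0 < rho0 <= 1 &
    forall (y : 'cV[R]_n -> 'cV[R]_m) x0 r0, 0 < r0 ->
    (forall u v, nrm (u - x0) <= r0 -> nrm (v - x0) <= r0 ->
      nrm (y u - y v) <= L * nrm (u - v)) ->
    exists c r (G : 'M[R]_(m, n)), [/\ rho0 * r0 <= r, nrm (c - x0) + r <= r0 &
      forall x, nrm (x - c) <= r ->
        sqnorm (y x - y c - G *m (x - c)) <= th * r ^+ 2].
Proof.
move=> L0 th0.
have t0 : 0 < Num.sqrt (th / (m%:R + 1)).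
  by rewrite sqrtr_gt0 divr_gt0 // ltr_wpDl.
have [rho0 rho01 H] := lip_family_affine n m L0 t0.
exists rho0 => // y x0 r0 r00 yL.
pose z i x := if insub i is Some j then y x j 0 else 0 : R.
have zE (i : 'I_m) x : z i x = y x i 0 by rewrite /z valK.
have [|c [r [h1 h2 h3]]] := H z x0 r0 r00.
  move=> i im u v hu hv; rewrite -[i]/(val (Ordinal im)) !zE.
  apply: le_trans (yL u v hu hv); apply: le_trans (nrm_coord _ (Ordinal im)).
  by rewrite !mxE.
have /choice[e eP] (i : 'I_m) : exists e : 'cV[R]_n, forall x, nrm (x - c) <= r ->
    `|y x i 0 - y c i 0 - dotv e (x - c)| <= Num.sqrt (th / (m%:R + 1)) * r.
  by have [e eP] := h3 i (ltn_ord i); exists e => x /eP; rewrite !zE.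
exists c, r, (\matrix_(i, j) e i j 0); split => // x xr.
apply: (@le_trans _ _ (\sum_(i < m) th / (m%:R + 1) * r ^+ 2)).
  apply: ler_sum => i _.
  have -> : (y x - y c - (\matrix_(i, j) e i j 0) *m (x - c)) i 0 =
      y x i 0 - y c i 0 - dotv (e i) (x - c).
    by rewrite !mxE dotvE; congr (_ - _); apply: eq_bigr => j _; rewrite !mxE.
  rewrite -real_normK ?num_real //.
  have sr : 0 <= Num.sqrt (th / (m%:R + 1)) * r.
    by rewrite mulr_ge0 ?sqrtr_ge0 //; exact: (le_trans (nrm_ge0 _) xr).
  have t1 : 0 <= th / (m%:R + 1) by rewrite divr_ge0 ?(ltW th0) // addr_ge0.
  rewrite -[X in X * _](sqr_sqrtr t1) -exprMn ler_sqr ?nnegrE //.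
  exact: eP.
rewrite sumr_const card_ord -[X in X <= _]mulr_natl.
rewrite mulrA ler_wpM2r ?sqr_ge0 // mulrCA ler_piMr ?(ltW th0) //.
by rewrite ler_pdivrMr ?mul1r ?lerDl // ltr_wpDl.
Qed.

End QuantitativeDifferentiation.

(** * Nearly extremal contact points *)

Section NearExtremalContact.
Variable R : realType.
Implicit Types n : nat.

(** Semiconvexity: g + Lam / 2 |.|^2 has an affine support at every point. The support is global, so
    restricting to balls needs no care. *)
Definition parab_supported n (g : 'cV[R]_n -> R) (Lam : R) :=
  forall x, exists p, forall z,
    g x + dotv p (z - x) - Lam / 2 * sqnorm (z - x) <= g z.

Definition qform_le n (A : 'M[R]_n) (l : R) := forall v, qform A v <= l * sqnorm v.

(** An upper contact jet with its radius kept, since the argument rescales to that ball. *)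
Definition contact_on n (g : 'cV[R]_n -> R) x (r : R) p A :=
  [/\ 0 < r, Defs.symmetric A & forall v, nrm v <= r ->
    g (x + v) <= g x + dotv p v + 2^-1 * qform A v].

(** * Hopf's barrier *)

Lemma bernoulli (U : R) j : -1 <= U -> 1 + j%:R * U <= (1 + U) ^+ j.
Proof.
move=> U1; elim: j => [|j IH]; first by rewrite mul0r addr0 expr0.
have U0 : 0 <= 1 + U by lra.
rewrite exprS; apply: le_trans (ler_wpM2l U0 IH).
rewrite -natr1; have : 0 <= j%:R :> R by []; have := sqr_ge0 U; nra.
Qed.

Lemma expr_lip (t s : R) j : 0 <= t <= 1 -> 0 <= s <= 1 ->
  t ^+ j <= s ^+ j + j%:R * `|t - s|.
Proof.
move=> /andP[t0 t1] /andP[s0 s1]; elim: j => [|j IH].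
  by rewrite !expr0 mul0r addr0.
rewrite !exprS -natr1.
have h1 : s ^+ j <= 1 by apply: exprn_ile1.
have h0 : 0 <= s ^+ j by apply: exprn_ge0.
have h2 := ler_norm (t - s); have h3 := normr_ge0 (t - s).
have h4 : 0 <= j%:R :> R by [].
have h5 := ler_wpM2l t0 IH.
have h6 : (t - s) * s ^+ j <= `|t - s| by nra.
have h7 : t * (j%:R * `|t - s|) <= j%:R * `|t - s|.
  by rewrite ler_piMl // mulr_ge0.
lra.
Qed.

(* Squaring Bernoulli's inequality gives a quadratic lower bound whose
   curvature [j^2] beats the slope [j] for large [j]. *)
Lemma barrier_lower (t0 a b : R) j : 0 < t0 -> 0 <= b ->
  j%:R * (2 * `|a| + b) <= t0 -> 2 * `|a| + b <= t0 -> j%:R * b <= t0 ->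
  t0 ^+ (2 * j) * (1 - (4 * j%:R / t0) * a - (3 * j%:R / t0) * b
    + (2 * j%:R ^+ 2 / t0 ^+ 2) * a ^+ 2) <= (t0 - 2 * a - b) ^+ (2 * j).
Proof.
move=> t00 b0 h1 h2 h3; pose U := - (2 * a + b) / t0.
have tE : t0 - 2 * a - b = t0 * (1 + U) by rewrite /U; field; lra.
have ha := ler_norm a; have hJ : 0 <= j%:R :> R by [].
have U1 : -1 <= U by rewrite /U ler_pdivlMr //; lra.
have jU : 0 <= 1 + j%:R * U.
  have : -1 <= j%:R * - (2 * a + b) / t0 by rewrite ler_pdivlMr //; nra.
  by rewrite /U mulrA; lra.
rewrite tE exprMn; apply: ler_wpM2l; first by rewrite exprn_ge0 // ltW.
rewrite (mulnC 2%N) exprM; apply: (@le_trans _ _ ((1 + j%:R * U) ^+ 2)); last first.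
  by rewrite ler_sqr ?nnegrE ?exprn_ge0 ?bernoulli //; lra.
(* In terms of V, the square of 1 - V (2 a + b) exceeds the claimed bound by V b + 2 V^2 (a + b)^2 -
   V^2 b^2, nonnegative since V b <= 1. *)
pose V := j%:R / t0; have V0 : 0 <= V by rewrite divr_ge0 // ltW.
have Vb : V * b <= 1 by rewrite /V mulrAC ler_pdivrMr // mul1r.
have -> : j%:R * U = - V * (2 * a + b) by rewrite /U /V; field; lra.
have -> : 4 * j%:R / t0 = 4 * V by rewrite /V mulrA.
have -> : 3 * j%:R / t0 = 3 * V by rewrite /V mulrA.
have -> : 2 * j%:R ^+ 2 / t0 ^+ 2 = 2 * V ^+ 2 by rewrite /V; field; lra.
have k1 : (V * b) ^+ 2 <= V * b by rewrite expr2 ler_piMr // mulr_ge0.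
have k2 := sqr_ge0 (V * (a + b)).
nra.
Qed.

(* The contact Hessian is that of the barrier with its gradient terms bounded
   below by [barrier_lower]. *)
Lemma barrier_contact n (k : 'cV[R]_n -> R) vs D (mu : R) j : 0 < mu -> (0 < j)%N ->
  0 < 4^-1 - sqnorm D -> nrm D <= 2^-1 ->
  (forall u, nrm (D + u) <= 2^-1 ->
    k (vs + u) + mu * (4^-1 - sqnorm (D + u)) ^+ (2 * j) <=
    k vs + mu * (4^-1 - sqnorm D) ^+ (2 * j)) ->
  let t0 := 4^-1 - sqnorm D in let V := j%:R / t0 in let P := mu * t0 ^+ (2 * j) in
  exists r p,
    contact_on k vs r p ((6 * P * V)%:M - (4 * P * V ^+ 2) *: (D *m D^T)) /\
    r <= 6^-1.
Proof.
move=> mu0 j0 t0_gt0 D12 H t0 V P.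
have J1 : 1 <= j%:R :> R by rewrite ler1n.
have J0 : 0 < j%:R :> R by apply: lt_le_trans J1.
have t0le : t0 <= 4^-1 by rewrite gerBl sqnorm_ge0.
have t0E : t0 = 4^-1 - sqnorm D by [].
clearbody t0; rewrite -t0E in t0_gt0 H.
(* On this radius [barrier_lower] applies: |D| <= 1/2 gives 2 |dotv D u| + |u|^2 <= 2 r = t0 / j. *)
pose r := t0 / (2 * j%:R).
have r0 : 0 < r by rewrite divr_gt0 // mulr_gt0.
have rj : 2 * j%:R * r = t0 by rewrite /r mulrCA mulfV ?mulr1 // gt_eqF // mulr_gt0.
clearbody r.
have rt : 2 * r <= t0 by clear -rj J1 r0; nra.
have small u : nrm u <= r -> 2 * `|dotv D u| + sqnorm u <= 2 * r /\ sqnorm u <= r.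
  move=> ur; have := normr_dotv D u; rewrite -sqr_nrm; have := nrm_ge0 u.
  by clear -ur rt t0le D12; nra.
exists r, ((4 * P * V) *: D); split; last by clear -rt t0le; lra.
split=> // [|u ur].
  rewrite /Defs.symmetric linearB /= tr_scalar_mx linearZ /=.
  by rewrite trmx_mul trmxK.
have [s1 s2] := small u ur.
have Du : nrm (D + u) <= 2^-1.
  rewrite le_nrm ?invr_ge0 // sqnormD.
  by have := ler_norm (dotv D u); clear -s1 rt t0E; lra.
have := H u Du.
have -> : 4^-1 - sqnorm (D + u) = t0 - 2 * dotv D u - sqnorm u.
  by rewrite sqnormD t0E; ring.
have c1 : j%:R * (2 * `|dotv D u| + sqnorm u) <= t0.
  by have := ler_wpM2l (ltW J0) s1; rewrite -rj; clear; lra.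
have c2 : 2 * `|dotv D u| + sqnorm u <= t0 by exact: le_trans s1 rt.
have c3 : j%:R * sqnorm u <= t0.
  by have := ler_wpM2l (ltW J0) s2; rewrite -rj; have := mulr_gt0 J0 r0; clear; lra.
have := barrier_lower t0_gt0 (sqnorm_ge0 u) c1 c2 c3.
have -> : 4 * j%:R / t0 = 4 * V by rewrite /V mulrA.
have -> : 3 * j%:R / t0 = 3 * V by rewrite /V mulrA.
have -> : 2 * j%:R ^+ 2 / t0 ^+ 2 = 2 * V ^+ 2 by rewrite /V; clear -t0_gt0; field; lra.
rewrite qformDl qformNl qform_scal.
have -> : qform ((4 * P * V ^+ 2) *: (D *m D^T)) u =
    4 * P * V ^+ 2 * dotv D u ^+ 2.
  by rewrite qformE -scalemxAl dotvZr -qformE qform_dyad.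
rewrite dotvZl => /(ler_wpM2l (ltW mu0)); rewrite mulrA -/P; clear; lra.
Qed.

(** The left side is P V times 6 + 6 sg n - 4 sg V DD^2. As t0 <= 1/4, V DD^2 >= 4 j d0^2, so the
    size of j makes that factor at most -1, and P V >= P >= c0. *)
Lemma barrier_trace (sg d0 DD t0 P c0 V : R) n j : 0 < sg -> 0 < d0 -> d0 < DD ->
  t0 = 4^-1 - DD ^+ 2 -> 0 < t0 -> (0 < j)%N ->
  7 + 6 * sg * n%:R <= 16 * sg * j%:R * d0 ^+ 2 -> 0 < P -> c0 <= P ->
  V * t0 = j%:R ->
  6 * P * V + sg * (n%:R * (6 * P * V) - 4 * P * V ^+ 2 * DD ^+ 2) <= - c0.
Proof.
move=> sg0 d00 dD t0E t0_gt0 j0 jbig P0 cP Vt.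
have J1 : 1 <= j%:R :> R by rewrite ler1n.
move: (j%:R) (n%:R) J1 Vt jbig => J N J1 Vt jbig.
have D2 : d0 ^+ 2 <= DD ^+ 2 by clear -d00 dD; nra.
have t0le : t0 <= 4^-1 by rewrite t0E gerBl sqr_ge0.
have V1 : 1 <= V by clear -J1 Vt t0_gt0 t0le; nra.
have d2 : 4 * d0 ^+ 2 * J <= V * DD ^+ 2.
  rewrite -Vt mulrCA; apply: ler_wpM2l; first by clear -V1; lra.
  by have := sqr_ge0 d0; clear -D2 t0le t0_gt0; nra.
have br : 6 + 6 * sg * N - 4 * sg * (V * DD ^+ 2) <= -1.
  by have := ler_wpM2l (ltW sg0) d2; clear -jbig; lra.
have PV : 0 <= P * V by rewrite mulr_ge0 ?(ltW P0) //; clear -V1; lra.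
have h := ler_wpM2l PV br.
have : P <= P * V by rewrite ler_peMr // ltW.
by clear -h cP; lra.
Qed.

(** The shape of the gap between [g] and a contact paraboloid, rescaled to the unit ball. *)
Definition normalised n (k : 'cV[R]_n -> R) (Lam : R) :=
  [/\ 0 < Lam, parab_supported k Lam, k 0 = 0 &
    forall v, nrm v <= 1 -> k v <= 0].

(** The slope of the support at 0 in the direction v is bounded through the opposite point -v, where
    k <= 0. *)
Lemma normalised_ge n (k : 'cV[R]_n -> R) Lam v :
  normalised k Lam -> nrm v <= 1 -> - Lam <= k v.
Proof.
move=> [Lam0 kL k0 k_le0] v1; have [p P] := kL 0.
have := P v; have := P (- v); rewrite k0 !subr0 sqnormN dotvNr => h1 h2.
have := k_le0 (- v); rewrite nrmN => /(_ v1) h3.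
have : sqnorm v <= 1 by rewrite -[1](expr1n _ 2) -le_nrm.
move=> /(ler_wpM2l (ltW Lam0)); lra.
Qed.

(** The support at v is tested at the point 1/6 beyond v on the ray from u, where k <= 0; this
    bounds its slope. That point stays in the unit ball because 5/6 + 1/6 = 1. *)
Lemma normalised_lip n (k : 'cV[R]_n -> R) Lam u v : normalised k Lam ->
  nrm u <= 5 / 6 -> nrm v <= 5 / 6 ->
  k v <= k u + 8 * Lam * nrm (v - u).
Proof.
move=> kn hu hv; have [Lam0 kL k0 k_le0] := kn; have [d0|d0] := eqVneq (nrm (v - u)) 0.
  by move/eqP: d0; rewrite nrm_eq0 subr_eq0 => /eqP ->; rewrite subrr nrm0 mulr0 addr0.
have {}d0 : 0 < nrm (v - u) by rewrite lt_def d0 nrm_ge0.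
set d := nrm (v - u) in d0 *.
have dle : d <= 5 / 3 by have := nrmB v u; rewrite -/d; lra.
have [p P] := kL v.
have Pu := P u; have := P (v + (6 * d)^-1 *: (v - u)).
have -> : v + (6 * d)^-1 *: (v - u) - v = (6 * d)^-1 *: (v - u).
  by rewrite addrC addKr.
have d6 : `|(6 * d)^-1| * d = 6^-1.
  rewrite ger0_norm; last by rewrite invr_ge0; lra.
  field; lra.
rewrite sqnormZ dotvZr -(sqr_nrm (v - u)) -/d -exprMn.
have -> : (6 * d)^-1 * d = 6^-1 by field; lra.
have kw : k (v + (6 * d)^-1 *: (v - u)) <= 0.
  apply: k_le0; apply: le_trans (nrmD _ _) _; rewrite nrmZ -/d d6; lra.
have kv : - Lam <= k v by apply: (normalised_ge kn); lra.
move: Pu; rewrite -(opprB v u) dotvNr sqnormN -sqr_nrm -/d => Pu h.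
have : (6 * d)^-1 * dotv p (v - u) <= Lam + Lam / 72 by lra.
rewrite mulrC ler_pdivrMr; last lra.
have : Lam * d ^+ 2 <= Lam * (d * (5 / 3)).
  by rewrite ler_wpM2l ?(ltW Lam0) // expr2 ler_wpM2l // ltW.
have : 0 <= Lam * d by rewrite mulr_ge0 // ltW.
lra.
Qed.

(* Hopf's barrier [(1/4 - |v - v1|^2)^(2j)], centred at the point [v1] where
   [k] is negative: adding a small multiple of it to [k] creates a contact
   point, and for large [j] the contact Hessian has a trace so negative that it
   outweighs its largest eigenvalue. *)
Lemma hopf_contact n (k : 'cV[R]_n -> R) Lam v1 (tau sg : R) :
  normalised k Lam -> 0 < tau -> 0 < sg -> nrm v1 <= 3^-1 -> k v1 < - tau ->
  forall (d0 : R) j, 0 < d0 <= 2^-1 -> 16 * Lam * d0 <= tau -> (0 < j)%N ->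
  7 + 6 * sg * n%:R <= 16 * sg * j%:R * d0 ^+ 2 ->
  exists x r p E mu, [/\ contact_on k x r p E, nrm x + r <= 1, 0 <= mu,
    qform_le E mu & mu + sg * \tr E <= - (tau / 2 * (5 / 36) ^+ (2 * j))].
Proof.
move=> kn tau0 sg0 v13 kv1 d0 j /andP[d00 d01] d0tau j0 jbig.
have [Lam0 kL k0 k_le0] := kn; pose C := [set v : 'cV[R]_n | nrm (v - v1) <= 2^-1].
pose t v := 4^-1 - sqnorm (v - v1).
pose T v := k v + tau / 2 * t v ^+ (2 * j).
have C56 v : C v -> nrm v <= 5 / 6.
  by rewrite /C /= => hv; have := nrmD (v - v1) v1; rewrite subrK; lra.
have t01 v : C v -> 0 <= t v <= 1.
  rewrite /C /= /t le_nrm ?invr_ge0 // => hv; have := sqnorm_ge0 (v - v1); lra.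
have C0 : C 0 by rewrite /C /= sub0r nrmN; lra.
have [vs Cvs vsmax] : exists2 v, C v & forall w, C w -> T w <= T v.
  apply: (@usc_max _ _ _ _ (5 / 6)) => //; first by exists 0.
    move=> v hv; rewrite /C /=; apply/ler_addgt0Pr => e e0.
    have [w Cw we] := hv e e0; have := nrmD (v - w) (w - v1).
    by rewrite subrKA (nrmBC v w); move: Cw; rewrite /C /=; lra.
  move=> v Cv e e0.
  pose K := 8 * Lam + tau / 2 * (2 * j)%:R.
  have J0 : 0 <= (2 * j)%:R :> R by [].
  have K0 : 0 < K.
    have : 0 <= tau / 2 * (2 * j)%:R by apply: mulr_ge0 => //; lra.
    by rewrite /K; lra.
  exists (e / K) => [|w Cw wv]; first exact: divr_gt0.
  have h1 := normalised_lip kn (C56 _ Cv) (C56 _ Cw).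
  have h2 := expr_lip (2 * j) (t01 _ Cw) (t01 _ Cv).
  have h3 : `|t w - t v| <= nrm (w - v).
    rewrite /t -!sqr_nrm.
    have -> : 4^-1 - nrm (w - v1) ^+ 2 - (4^-1 - nrm (v - v1) ^+ 2) =
      (nrm (v - v1) - nrm (w - v1)) * (nrm (v - v1) + nrm (w - v1)) by ring.
    have p1 := nrmD (v - w) (w - v1); have p2 := nrmD (w - v) (v - v1).
    rewrite !subrKA (nrmBC v w) in p1 p2.
    move: Cv Cw; rewrite /C /= => c1 c2.
    have q1 := nrm_ge0 (v - v1); have q2 := nrm_ge0 (w - v1).
    have q3 := nrm_ge0 (w - v).
    rewrite ler_norml; apply/andP; split; nra.
  move: wv; rewrite ltr_pdivlMr // /K /T => h4.
  have h5 := ler_wpM2l J0 h3.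
  have h6 : t w ^+ (2 * j) <= t v ^+ (2 * j) + (2 * j)%:R * nrm (w - v) by lra.
  have tau2 : 0 <= tau / 2 by lra.
  have := ler_wpM2l tau2 h6; lra.
pose D := vs - v1; pose t0 := t vs; pose w0 := t0 ^+ (2 * j).
have t0E : t0 = 4^-1 - nrm D ^+ 2 by rewrite /t0 /t sqr_nrm.
have [t0ge t0le] : 0 <= t0 /\ t0 <= 1 by apply/andP; exact: t01.
(* 5/36 = 1/4 - 1/9 bounds [t] from below at the origin, as |v1| <= 1/3. So the maximum of [T] is
   positive, which keeps [vs] off the boundary, where the barrier vanishes and k <= 0. *)
pose w00 : R := (5 / 36) ^+ (2 * j).
have w00_gt0 : 0 < w00 by rewrite exprn_gt0 // divr_gt0.
have w00t : w00 <= t 0 ^+ (2 * j).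
  rewrite lerXn2r ?nnegrE ?divr_ge0 //.
    by case/andP: (t01 0 C0).
  rewrite /t sub0r sqnormN; move: v13; rewrite le_nrm ?invr_ge0 //; lra.
have tau2 : 0 < tau / 2 by lra.
have Tvs : tau / 2 * w00 <= k vs + tau / 2 * w0.
  apply: le_trans (vsmax 0 C0); rewrite /T k0 add0r ler_wpM2l // ltW //.
have kvs : k vs <= 0 by apply: k_le0; have := C56 _ Cvs; lra.
have w0w : w00 <= w0 by rewrite -(ler_pM2l tau2); lra.
have w0_gt0 : 0 < w0 by lra.
have t0_gt0 : 0 < t0.
  rewrite lt_def t0ge andbT; apply/eqP => t00; move: w0_gt0.
  by rewrite /w0 t00 expr0n muln_eq0 /= (gtn_eqF j0) ltxx.
have w0le1 : w0 <= 1 by apply: exprn_ile1.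
(* Within [d0] of [v1] the Lipschitz bound keeps k below -tau / 2, which the barrier, at most tau /
   2, cannot lift to a positive value. *)
have Dd0 : d0 < nrm D.
  rewrite ltNge; apply/negP => hD.
  have := normalised_lip kn (u := v1) (v := vs) _ (C56 _ Cvs).
  have -> : nrm v1 <= 5 / 6 = true by apply/idP; lra.
  move=> /(_ isT); rewrite -/D => h.
  have : 8 * Lam * nrm D <= 8 * Lam * d0 by rewrite ler_wpM2l //; lra.
  have : tau / 2 * w0 <= tau / 2 by rewrite ler_piMr // ltW.
  have : 0 < tau / 2 * w00 by rewrite mulr_gt0.
  lra.
have T_le u : nrm (D + u) <= 2^-1 ->
    k (vs + u) + tau / 2 * (4^-1 - sqnorm (D + u)) ^+ (2 * j) <=
    k vs + tau / 2 * (4^-1 - sqnorm D) ^+ (2 * j).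
  have DuE : vs + u - v1 = D + u by rewrite /D addrAC.
  by move=> hu; have := vsmax (vs + u); rewrite /C /T /t /= DuE; exact.
have t0_gt0' : 0 < 4^-1 - sqnorm D by [].
have [r [p [hc r6]]] := barrier_contact tau2 j0 t0_gt0' Cvs T_le.
pose V := j%:R / t0; pose P := tau / 2 * w0.
have V0 : 0 < V by rewrite divr_gt0 // ltr0n.
have P0 : 0 < P by rewrite mulr_gt0.
exists vs, r, p, ((6 * P * V)%:M - (4 * P * V ^+ 2) *: (D *m D^T)), (6 * P * V).
split=> //.
- by have := C56 _ Cvs; move: r6; clear; lra.
- by rewrite -mulrA mulr_ge0 // mulr_ge0 ?(ltW P0) ?(ltW V0).
- move=> u; rewrite qformDl qformNl qform_scal.
  rewrite qformE -scalemxAl dotvZr -qformE qform_dyad lerBlDr lerDl.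
  apply: mulr_ge0; last exact: sqr_ge0.
  by apply: mulr_ge0; [rewrite mulr_ge0 // ltW|exact: sqr_ge0].
- rewrite linearB /= linearZ /= mxtrace_scalar.
  have -> : \tr (D *m D^T) = nrm D ^+ 2.
    by rewrite mxtrace_mulC trace_mx11 sqr_nrm sqnormE.
  rewrite -[_ *+ n]mulr_natl; apply: (barrier_trace sg0 d00 Dd0 t0E t0_gt0 j0 jbig).
  + by rewrite mulr_gt0.
  + by rewrite /P ler_pM2l.
  + by rewrite /V divfK // gt_eqF.
Qed.

(** [d0] and [j] are fixed by n, Lam, tau and sg alone, so the gain [c] is uniform in [k]. *)
Lemma parab_improve n (Lam tau sg : R) : 0 < Lam -> 0 < tau -> 0 < sg ->
  exists2 c : R, 0 < c & forall k : 'cV[R]_n -> R, normalised k Lam ->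
    forall v, nrm v <= 3^-1 -> k v < - tau ->
    exists x r p E mu, [/\ contact_on k x r p E, nrm x + r <= 1, 0 <= mu,
      qform_le E mu & mu + sg * \tr E <= - c].
Proof.
move=> Lam0 tau0 sg0.
pose d0 := Num.min 2^-1 (tau / (16 * Lam)).
have Lam16 : 0 < 16 * Lam by lra.
have d00 : 0 < d0 by rewrite /d0 lt_min invr_gt0 ltr0n /= divr_gt0.
have d01 : d0 <= 2^-1 by rewrite /d0 ge_min lexx.
have d02 : 16 * Lam * d0 <= tau.
  by rewrite mulrC -ler_pdivlMr // /d0 ge_min lexx orbT.
have q0 : 0 < 16 * sg * d0 ^+ 2 by rewrite !mulr_gt0 // exprn_gt0.
pose j := (Num.bound ((7 + 6 * sg * n%:R) / (16 * sg * d0 ^+ 2))).+1.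
have N0 : 0 <= n%:R :> R by [].
have jP : 7 + 6 * sg * n%:R <= 16 * sg * j%:R * d0 ^+ 2.
  have := archi_boundP (_ : 0 <= (7 + 6 * sg * n%:R) / (16 * sg * d0 ^+ 2)).
  have -> : 0 <= (7 + 6 * sg * n%:R) / (16 * sg * d0 ^+ 2) = true.
    apply/idP; rewrite divr_ge0 ?(ltW q0) //; nra.
  move=> /(_ isT); rewrite ltr_pdivrMr // /j -natr1; lra.
exists (tau / 2 * (5 / 36) ^+ (2 * j)).
  by rewrite mulr_gt0 ?exprn_gt0 ?divr_gt0.
move=> k kn v v3 kv.
apply: (hopf_contact kn tau0 sg0 v3 kv _ d02 _ jP) => //.
by rewrite d00.
Qed.

(** * Almost minimal contact Hessians *)

Lemma contact_supported_ge n (g : 'cV[R]_n -> R) Lam x r p A :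
  parab_supported g Lam -> contact_on g x r p A ->
  forall v, - Lam * sqnorm v <= qform A v.
Proof.
move=> gL [r0 sA gA] v; have [q Q] := gL x.
have [v0|v0] := eqVneq (nrm v) 0.
  by move/eqP: v0; rewrite nrm_eq0 => /eqP ->; rewrite sqnorm0 mulr0 qform0.
have {}v0 : 0 < nrm v by rewrite lt_def v0 nrm_ge0.
pose t := r / nrm v; have t0 : 0 < t by rewrite divr_gt0.
have tv : nrm (t *: v) <= r by rewrite nrmZ gtr0_norm // /t divfK // gt_eqF.
have := gA (t *: v) tv; have := gA (- (t *: v)); rewrite nrmN => /(_ tv).
have := Q (x + t *: v); have := Q (x - t *: v).
rewrite ![x + _]addrC !addrK !dotvNr !qformN !sqnormN !qformZ !sqnormZ => h1 h2 h3 h4.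
have t2 : 0 < t ^+ 2 by rewrite exprn_gt0.
rewrite -(ler_pM2l t2); lra.
Qed.

(** An almost minimiser of l + sg tr A has value close to at most 0, that of the zero jet; as sg tr
    A >= -s / 2, this forces l <= s. A gap above tau r^2 inside the third of its ball would let
    [parab_improve] lower the functional by [c], below the infimum. *)
Lemma near_extremal n (g : 'cV[R]_n -> R) (Lam a s tau : R) :
  0 < Lam -> 0 < a -> 0 < s -> 0 < tau -> parab_supported g Lam -> g 0 = 0 ->
  (forall x, nrm x <= a -> g x <= 0) ->
  exists x r p A, [/\ contact_on g x r p A, nrm x + r <= a, qform_le A s &
    forall v, nrm v <= r / 3 ->
      g x + dotv p v + 2^-1 * qform A v - tau * r ^+ 2 <= g (x + v)].
Proof.
move=> Lam0 a0 s0 tau0 gL g0 g_le0.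
have N0 : 0 <= n%:R :> R by [].
pose sg := s / (2 * (n%:R * Lam + 1)).
have den : 0 < 2 * (n%:R * Lam + 1) by nra.
have sg0 : 0 < sg by rewrite divr_gt0.
have sgn : sg * (n%:R * Lam) <= s / 2.
  rewrite /sg mulrAC ler_pdivrMr //; nra.
have LamS : 0 < Lam + s by lra.
have [c c0 cP] := parab_improve n LamS tau0 sg0.
(* [l] ranges over nonnegative upper bounds of [A] in place of the largest eigenvalue, so no
   eigenvalue has to be extracted. *)
pose S := [set m | exists x r p A l, [/\ contact_on g x r p A, nrm x + r <= a,
  0 <= l, qform_le A l & m = l + sg * \tr A]].
have trA x r p A : contact_on g x r p A -> - (n%:R * Lam) <= \tr A.
  move=> /(contact_supported_ge gL) hA.
  have -> : - (n%:R * Lam) = \sum_(i < n) - Lam.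
    by rewrite sumr_const card_ord mulr_natl mulNrn.
  apply: ler_sum => i _; have := hA (delta_mx i 0).
  by rewrite sqnorm_delta mulr1 qform_delta.
have S0 : S 0.
  exists 0, a, 0, 0, 0; rewrite nrm0 add0r mxtrace0 mulr0 addr0; split=> //.
    split=> // [|v va]; first by rewrite /Defs.symmetric trmx0.
    by rewrite add0r g0 dotv0l qformE mul0mx dotv0r mulr0 !addr0 g_le0.
  by move=> v; rewrite qformE mul0mx dotv0r mul0r.
have Slb m : S m -> - (s / 2) <= m.
  move=> [x [r [p [A [l [hA _ l0 _ ->]]]]]].
  have := ler_wpM2l (ltW sg0) (trA _ _ _ _ hA); lra.
have hS : has_inf S by split; [exists 0|exists (- (s / 2)) => m /Slb].
have i0 : inf S <= 0 by apply: ge_inf S0; exact: hS.2.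
have e0 : 0 < Num.min c (s / 2) by rewrite lt_min c0 divr_gt0.
have [m [x [r [p [A [l [hA xr l0 Al mE]]]]]] mlt] := inf_adherent e0 hS.
have mc : m < inf S + c by apply: lt_le_trans mlt _; rewrite lerD2l ge_min lexx.
have ms : m < inf S + s / 2.
  by apply: lt_le_trans mlt _; rewrite lerD2l ge_min lexx orbT.
have ls : l <= s.
  have := ler_wpM2l (ltW sg0) (trA _ _ _ _ hA); lra.
have As : qform_le A s.
  by move=> v; apply: le_trans (Al v) _; rewrite ler_wpM2r ?sqnorm_ge0.
exists x, r, p, A; split => //.
have [r0 sA gA] := hA.
have r2 : 0 < r ^+ 2 by rewrite exprn_gt0.
(* The rescaled gap. Subtracting a paraboloid of Hessian at most [s] raises the support constant
   from [Lam] to [Lam + s]. *)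
pose k v := (g (x + r *: v) - g x - dotv p (r *: v)) / r ^+ 2 - 2^-1 * qform A v.
have kE v : g (x + r *: v) = g x + dotv p (r *: v) + 2^-1 * qform A (r *: v)
    + r ^+ 2 * k v.
  rewrite /k qformZ; field; lra.
have kn : normalised k (Lam + s).
  split=> //.
  - move=> v; have [q Q] := gL (x + r *: v).
    exists (r^-1 *: (q - p) - A *m v) => z.
    have [w ->] : exists w, z = v + w by exists (z - v); rewrite addrC subrK.
    have := Q (x + r *: (v + w)); rewrite !kE.
    have -> : x + r *: (v + w) - (x + r *: v) = r *: w.
      by apply/colP => i; rewrite !mxE; ring.
    have -> : v + w - v = w by rewrite addrC addKr.
    rewrite sqnormZ !qformZ; have := As w.
    rewrite qformD // !dotvL => h1 h2.
    rewrite -(ler_pM2l r2).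
    have -> : r ^+ 2 * (k v + (r^-1 * (dotv q w - dotv p w) - dotv (A *m v) w)
        - (Lam + s) / 2 * sqnorm w) = r ^+ 2 * k v + r * dotv q w - r * dotv p w
       - r ^+ 2 * dotv (A *m v) w - r ^+ 2 * ((Lam + s) / 2 * sqnorm w).
      field; lra.
    have := ler_wpM2l (ltW r2) h1; lra.
  - by rewrite /k scaler0 addr0 dotv0r qform0 subrr subr0 mul0r mulr0 subrr.
  - move=> v v1; rewrite -(ler_pM2l r2) mulr0.
    have := gA (r *: v); rewrite kE nrmZ gtr0_norm // ler_piMr ?(ltW r0) //.
    by move=> /(_ isT); lra.
move=> v vr.
have [u uE] : exists u, v = r *: u.
  by exists (r^-1 *: v); rewrite scalerA divff ?scale1r // gt_eqF.
have u3 : nrm u <= 3^-1.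
  by move: vr; rewrite uE nrmZ gtr0_norm // ler_pM2l.
suff ku : - tau <= k u by have := ler_wpM2l (ltW r2) ku; rewrite uE kE; lra.
rewrite leNgt; apply/negP => ku.
have [x' [r' [p' [E [mu [hE xr' mu0 Emu muE]]]]]] := cP k kn u u3 ku.
have [r'0 sE kE'] := hE.
suff : S (l + mu + sg * \tr (A + E)).
  move=> /(ge_inf hS.2); rewrite linearD /=; lra.
(* A contact jet of [k] gives one of [g]: the factor r^2 makes the Hessians add, and the old
   paraboloid has gradient p + r A x' at the new point. *)
exists (x + r *: x'), (r * r'), (p + r *: p' + r *: (A *m x')), (A + E), (l + mu).
split=> //; last 2 first.
- exact: addr_ge0.
- move=> w; rewrite qformDl mulrDl; exact: lerD.
- split; first by rewrite mulr_gt0.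
    by rewrite /Defs.symmetric linearD /= sA sE.
  move=> w wr.
  have [z zE] : exists z, w = r *: z.
    by exists (r^-1 *: w); rewrite scalerA divff ?scale1r // gt_eqF.
  have zr : nrm z <= r'.
    by move: wr; rewrite zE nrmZ gtr0_norm // ler_pM2l.
  have -> : x + r *: x' + w = x + r *: (x' + z).
    by rewrite zE scalerDr addrA.
  have := ler_wpM2l (ltW r2) (kE' z zr).
  rewrite !kE zE !qformZ qformD // qformDl !dotvL; lra.
- apply: le_trans xr; apply: (@le_trans _ _ (nrm x + r * nrm x' + r * r')).
    by rewrite lerD2r; apply: le_trans (nrmD _ _) _; rewrite nrmZ gtr0_norm.
  by rewrite -addrA lerD2l -mulrDr ler_piMr // ltW.
Qed.

(** The order of choices matters: the scale ratio [rho] of the affine approximation depends only on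
    n, m, L and th, so the gap tolerance can be chosen after it. *)
Lemma near_quadratic_near_affine n m (g : 'cV[R]_n -> R) (y : 'cV[R]_n -> 'cV[R]_m)
    (Lam L a s th : R) :
  0 < Lam -> 0 <= L -> 0 < a -> 0 < s -> 0 < th -> parab_supported g Lam ->
  g 0 = 0 -> (forall x, nrm x <= a -> g x <= 0) ->
  (forall u v, nrm u <= a -> nrm v <= a -> nrm (y u - y v) <= L * nrm (u - v)) ->
  exists c r p A (G : 'M[R]_(m, n)), [/\ 0 < r, nrm c + r <= a,
    Defs.symmetric A, qform_le A s & forall v, nrm v <= r ->
      sqnorm (y (c + v) - y c - G *m v) <= th * r ^+ 2 /\
      g (c + v) <= g c + dotv p v + 2^-1 * qform A v + th * r ^+ 2].
Proof.
move=> Lam0 L0 a0 s0 th0 gL g0 g_le0 yL.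
have [rho /andP[rho0 rho1] H] := lip_map_affine n m L0 th0.
(* The affine ball has radius r1 >= rho r / 3, so this tolerance times r^2 is at most th r1^2. *)
have tau0 : 0 < th * (rho / 3) ^+ 2 by rewrite mulr_gt0 // exprn_gt0 // divr_gt0.
have [x [r [p [A [[r0 sA gA] xr As gge]]]]] :=
  near_extremal Lam0 a0 s0 tau0 gL g0 g_le0.
have r3 : 0 < r / 3 by rewrite divr_gt0.
have [|c [r1 [G [h1 h2 h3]]]] := H y x (r / 3) r3.
  move=> u v hu hv; apply: yL.
    by have := nrmD (u - x) x; rewrite subrK; lra.
  by have := nrmD (v - x) x; rewrite subrK; lra.
have r10 : 0 < r1 by apply: lt_le_trans h1; rewrite mulr_gt0.
exists c, r1, (p + A *m (c - x)), A, G; split => //.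
  by have := nrmD (c - x) x; rewrite subrK; lra.
move=> v vr; split.
  by have := h3 (c + v); rewrite [c + v - c]addrC addKr; exact.
have cx : nrm (c - x) <= r / 3 by have := nrm_ge0 v; lra.
have := gge (c - x) cx; have := gA (c - x + v) _.
have -> : x + (c - x) = c by rewrite addrC subrK.
have -> : x + (c - x + v) = c + v by rewrite addrA [x + _]addrC subrK.
have -> : nrm (c - x + v) <= r = true.
  by apply/idP; have := nrmD (c - x) v; lra.
move=> /(_ isT); rewrite qformD // !dotvL => k1 k2.
have : (rho / 3) ^+ 2 * r ^+ 2 <= r1 ^+ 2.
  by rewrite -exprMn ler_sqr ?nnegrE; nra.
move=> /(ler_wpM2l (ltW th0)); lra.
Qed.

End NearExtremalContact.

(** * Continuity of polynomial expressions *)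

Section ContinuityOfPolynomials.
Variable R : realType.

Definition cont k (f : 'cV[R]_k -> R) := forall v (e : R), 0 < e ->
  exists2 d : R, 0 < d & forall w, nrm (w - v) < d -> `|f w - f v| < e.

Definition vcont k l (u : 'cV[R]_k -> 'cV[R]_l) := forall i, cont (fun z => u z i 0).

Lemma cont_cst k (c : R) : cont (fun _ : 'cV[R]_k => c).
Proof. by move=> v e e0; exists 1 => // w _; rewrite subrr normr0. Qed.

Lemma cont_coord k (i : 'I_k) : cont (fun z : 'cV[R]_k => z i 0).
Proof.
move=> v e e0; exists e => // w wv; apply: le_lt_trans wv.
by have := nrm_coord (w - v) i; rewrite !mxE.
Qed.

Lemma contD k (f g : 'cV[R]_k -> R) : cont f -> cont g -> cont (fun z => f z + g z).
Proof.
move=> cf cg v e e0; have e2 : 0 < e / 2 by rewrite divr_gt0.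
have [d d0 fd] := cf v _ e2; have [d' d'0 gd] := cg v _ e2.
exists (Num.min d d'); first by rewrite lt_min d0.
move=> w; rewrite lt_min => /andP[/fd h1 /gd h2].
rewrite opprD addrACA; apply: le_lt_trans (ler_normD _ _) _; lra.
Qed.

Lemma contM k (f g : 'cV[R]_k -> R) : cont f -> cont g -> cont (fun z => f z * g z).
Proof.
move=> cf cg v e e0.
pose M := `|f v| + `|g v| + 1.
have Mf : 0 <= `|f v| by []. have Mg : 0 <= `|g v| by [].
have M0 : 0 < M by rewrite /M; lra.
pose e1 := Num.min 1 (e / (2 * M)).
have e10 : 0 < e1 by rewrite /e1 lt_min ltr01 /= divr_gt0 ?mulr_gt0.
have e11 : e1 <= 1 by rewrite /e1 ge_min lexx.
have e1M : e1 * (2 * M) <= e.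
  by rewrite -ler_pdivlMr ?mulr_gt0 // /e1 ge_min lexx orbT.
have [d d0 fd] := cf v _ e10; have [d' d'0 gd] := cg v _ e10.
exists (Num.min d d'); first by rewrite lt_min d0.
move=> w; rewrite lt_min => /andP[/fd h1 /gd h2].
have -> : f w * g w - f v * g v =
    (f w - f v) * (g w - g v) + (f v * (g w - g v) + g v * (f w - f v)) by ring.
apply: le_lt_trans (ler_normD _ _) _.
have := ler_normD (f v * (g w - g v)) (g v * (f w - f v)); rewrite !normrM.
have x0 := normr_ge0 (f w - f v); have y0 := normr_ge0 (g w - g v).
have p1 := ler_wpM2l Mf (ltW h2); have p2 := ler_wpM2l Mg (ltW h1).
have p3 : `|f w - f v| * `|g w - g v| <= e1 by nra.
by rewrite /M in e1M; lra.
Qed.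

Lemma cont_sum k (I : finType) (F : I -> 'cV[R]_k -> R) :
  (forall i, cont (F i)) -> cont (fun z => \sum_i F i z).
Proof.
move=> cF; suff : forall r : seq I, cont (fun z => \sum_(i <- r) F i z) by exact.
elim=> [|i r IH] v e e0.
  by have [d d0 h] := cont_cst (0 : R) v e0; exists d => // w /h; rewrite !big_nil.
by have [d d0 h] := contD (cF i) IH v e0; exists d => // w /h; rewrite !big_cons.
Qed.

Lemma vcont_cst k l (c : 'cV[R]_l) : vcont (fun _ : 'cV[R]_k => c).
Proof. by move=> i; exact: cont_cst. Qed.

Lemma vcontD k l (u v : 'cV[R]_k -> 'cV[R]_l) :
  vcont u -> vcont v -> vcont (fun z => u z + v z).
Proof.
move=> cu cv i w e /(contD (cu i) (cv i) w)[d d0 h].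
by exists d => // z /h; rewrite !mxE.
Qed.

Lemma vcont_mulmx k l q (M : 'M[R]_(q, l)) (u : 'cV[R]_k -> 'cV[R]_l) :
  vcont u -> vcont (fun z => M *m u z).
Proof.
move=> cu i w e e0.
have [d d0 h] := cont_sum (fun j => contM (cont_cst (M i j)) (cu j)) w e0.
by exists d => // z /h; rewrite !mxE.
Qed.

Lemma vcontB k l (u v : 'cV[R]_k -> 'cV[R]_l) :
  vcont u -> vcont v -> vcont (fun z => u z - v z).
Proof.
move=> cu cv i w e e0.
have [d d0 h] := vcontD cu (vcont_mulmx (- 1%:M) cv) i w e0.
by exists d => // z /h; rewrite !mulNmx !mul1mx.
Qed.

Lemma vcont_usub k l : vcont (fun z : 'cV[R]_(k + l) => usubmx z).
Proof.
move=> i w e e0; have [d d0 h] := cont_coord (lshift l i) w e0.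
by exists d => // z /h; rewrite !mxE.
Qed.

Lemma vcont_dsub k l : vcont (fun z : 'cV[R]_(k + l) => dsubmx z).
Proof.
move=> i w e e0; have [d d0 h] := cont_coord (rshift k i) w e0.
by exists d => // z /h; rewrite !mxE.
Qed.

Lemma cont_dotv k l (u v : 'cV[R]_k -> 'cV[R]_l) :
  vcont u -> vcont v -> cont (fun z => dotv (u z) (v z)).
Proof.
move=> cu cv w e e0.
have [d d0 h] := cont_sum (fun j => contM (cu j) (cv j)) w e0.
by exists d => // z /h; rewrite !dotvE.
Qed.

Lemma cont_sqnorm k l (u : 'cV[R]_k -> 'cV[R]_l) :
  vcont u -> cont (fun z => sqnorm (u z)).
Proof.
move=> cu w e e0; have [d d0 h] := cont_dotv cu cu w e0.
by exists d => // z /h; rewrite !sqnormE.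
Qed.

Lemma cont_qform k l A (u : 'cV[R]_k -> 'cV[R]_l) :
  vcont u -> cont (fun z => qform A (u z)).
Proof.
move=> cu w e e0; have [d d0 h] := cont_dotv cu (vcont_mulmx A cu) w e0.
by exists d => // z /h; rewrite !qformE.
Qed.

Lemma cont_scale k a (f : 'cV[R]_k -> R) : cont f -> cont (fun z => a * f z).
Proof. by move=> cf; apply: contM cf; exact: cont_cst. Qed.

Lemma contB k (f g : 'cV[R]_k -> R) : cont f -> cont g -> cont (fun z => f z - g z).
Proof.
move=> cf cg v e e0.
have [d d0 h] := contD cf (cont_scale (-1) cg) v e0.
by exists d => // z /h; rewrite !mulN1r.
Qed.

Lemma usc_atD k (C : set 'cV[R]_k) f g v : usc_at C f v -> cont g ->
  usc_at C (fun z => f z + g z) v.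
Proof.
move=> uf cg e e0; have e2 : 0 < e / 2 by rewrite divr_gt0.
have [d d0 fd] := uf _ e2; have [d' d'0 gd] := cg v _ e2.
exists (Num.min d d'); first by rewrite lt_min d0.
move=> w Cw; rewrite lt_min => /andP[/(fd _ Cw) h1 /gd h2].
have := ler_norm (g w - g v); lra.
Qed.

Lemma closed_le k (g : 'cV[R]_k -> R) c : cont g -> closed_pts [set v | g v <= c].
Proof.
move=> cg v H /=; apply/ler_addgt0Pr => e e0.
have [d d0 h] := cg v e e0; have [w /= wc wv] := H d d0.
have := h w wv; rewrite ltr_norml => /andP[]; lra.
Qed.

Lemma closedI k (C D : set 'cV[R]_k) :
  closed_pts C -> closed_pts D -> closed_pts (C `&` D).
Proof.
move=> cC cD v H; split; [apply: cC|apply: cD] => e /H[w [Cw Dw] ?]; by exists w.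
Qed.

Lemma vcont_id k : vcont (fun z : 'cV[R]_k => z).
Proof. by move=> i; exact: cont_coord. Qed.

Lemma closed_nrm_le k l (u : 'cV[R]_k -> 'cV[R]_l) r : 0 <= r -> vcont u ->
  closed_pts [set v | nrm (u v) <= r].
Proof.
move=> r0 cu v H /=; rewrite le_nrm //.
apply: (closed_le (cont_sqnorm cu) (c := r ^+ 2)) => e /H[w /= wr ?].
by exists w => //=; rewrite -le_nrm.
Qed.

End ContinuityOfPolynomials.

(** * Sup-convolution in the first variable *)

Section SupConvolution.
Variable R : realType.

Definition mid k (u v : 'cV[R]_k) := 2^-1 *: (u + v).

Lemma midE k (u v : 'cV[R]_k) : mid u v = (1 - 2^-1) *: u + 2^-1 *: v.
Proof. by rewrite /mid scalerDr; congr (_ *: _ + _); field. Qed.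

Lemma half01 : 0 <= (2^-1 : R) <= 1.
Proof. by rewrite invr_ge0 ler0n invf_le1 ?ler1n. Qed.

Lemma nrm_mid k (u v : 'cV[R]_k) r : nrm u <= r -> nrm v <= r -> nrm (mid u v) <= r.
Proof.
move=> hu hv; rewrite midE -[X in nrm X]subr0.
by apply: (conv_in_ball half01); rewrite subr0.
Qed.

Lemma sqnorm_mid k (u v : 'cV[R]_k) :
  2 * sqnorm (mid u v) = sqnorm u + sqnorm v - 2^-1 * sqnorm (u - v).
Proof. by rewrite midE sqnorm_conv; field. Qed.

(** The local model: the regularised function minus the contact paraboloid, centred at the contact
    point. It is jointly semiconcave and strongly convex in y, and its marginal over the y-ball is
    at most 0, with value 0 at the origin. *)
Record saddle n m (f : 'cV[R]_n -> 'cV[R]_m -> R) (a b K eps M : R) : Prop := Saddle {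
  saddle_a : 0 < a;
  saddle_b : 0 < b;
  saddle_K : 0 < K;
  saddle_eps : 0 < eps;
  saddle_cont : forall x y, nrm x <= a -> nrm y <= b -> forall e : R, 0 < e ->
    exists2 d : R, 0 < d & forall x' y', nrm x' <= a -> nrm y' <= b ->
      nrm (x' - x) < d -> nrm (y' - y) < d -> `|f x' y' - f x y| < e;
  saddle_semi : forall x1 x2 y1 y2, nrm x1 <= a -> nrm x2 <= a ->
    nrm y1 <= b -> nrm y2 <= b ->
    f x1 y1 + f x2 y2 <= 2 * f (mid x1 x2) (mid y1 y2)
      + K * (sqnorm (x1 - x2) + sqnorm (y1 - y2));
  saddle_conv : forall x y1 y2 t, nrm x <= a -> nrm y1 <= b -> nrm y2 <= b ->
    0 <= t <= 1 -> f x ((1 - t) *: y1 + t *: y2) <=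
      (1 - t) * f x y1 + t * f x y2 - eps * (t * (1 - t)) * sqnorm (y1 - y2);
  saddle_bd : forall x y, nrm x <= a -> nrm y <= b -> `|f x y| <= M;
  saddle_00 : f 0 0 = 0;
  saddle_ge : forall y, nrm y <= b -> 0 <= f 0 y;
  saddle_le : forall x, nrm x <= a -> forall e : R, 0 < e ->
    exists2 y, nrm y <= b & f x y <= e }.

Definition penal n m (f : 'cV[R]_n -> 'cV[R]_m -> R) (B : R) x x' y :=
  f x' y - B * sqnorm (x - x').

(** Specified by bound and attainment, so that maximisers are at hand. [x] ranges over the whole
    space and only [x'] is confined, which makes the supports of the marginal global. *)
Record supconv n m (f : 'cV[R]_n -> 'cV[R]_m -> R) (a b B : R)
    (h : 'cV[R]_n -> 'cV[R]_m -> R) : Prop := Supconv {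
  supconv_ge : forall x x' y, nrm y <= b -> nrm x' <= a -> penal f B x x' y <= h x y;
  supconv_att : forall x y, nrm y <= b ->
    exists2 x', nrm x' <= a & h x y = penal f B x x' y }.

Record argmin_of n m (h : 'cV[R]_n -> 'cV[R]_m -> R) (b : R)
    (ym : 'cV[R]_n -> 'cV[R]_m) : Prop := ArgminOf {
  argmin_in : forall x, nrm (ym x) <= b;
  argmin_le : forall x y, nrm y <= b -> h x (ym x) <= h x y }.

Section FixedSaddle.
Variables (n m : nat) (f : 'cV[R]_n -> 'cV[R]_m -> R).

Lemma penal_usc a b K eps M B x y x' : saddle f a b K eps M ->
  nrm y <= b -> nrm x' <= a ->
  usc_at [set v | nrm v <= a] (fun v => penal f B x v y) x'.
Proof.
move=> sd yb xa; apply: usc_atD.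
  move=> e /(saddle_cont sd xa yb)[d d0 h]; exists d => // w /= wa wd.
  have := h w y wa yb wd; rewrite subrr nrm0 => /(_ d0).
  by rewrite ltr_norml => /andP[]; lra.
move=> v e e0.
have [d d0 hd] := cont_scale (- B)
  (cont_sqnorm (vcontB (@vcont_cst R n n x) (@vcont_id R n))) v e0.
by exists d => // w /hd; rewrite !mulNr.
Qed.

Lemma supconv_exists a b K eps M B : saddle f a b K eps M ->
  exists h, supconv f a b B h.
Proof.
move=> sd.
have /choice[xm xmP] (p : 'cV[R]_n * 'cV[R]_m) : exists x', nrm p.2 <= b ->
    nrm x' <= a /\ forall w, nrm w <= a -> penal f B p.1 w p.2 <= penal f B p.1 x' p.2.
  have [yb|_] := boolP (nrm p.2 <= b); last by exists 0.
  have [||||x' xa H] := @usc_max R n [set v | nrm v <= a] (fun v => penal f B p.1 v p.2) a.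
  - by exists 0; rewrite /= nrm0 ltW // (saddle_a sd).
  - by [].
  - by apply: closed_nrm_le; [exact: ltW (saddle_a sd)|exact: vcont_id].
  - by move=> v va; exact: penal_usc sd yb va.
  - by exists x'.
exists (fun x y => penal f B x (xm (x, y)) y); split.
  by move=> x x' y yb xa; exact: (xmP (x, y) yb).2.
by move=> x y yb; exists (xm (x, y)) => //; exact: (xmP (x, y) yb).1.
Qed.

Variables (a b K eps M B : R) (h : 'cV[R]_n -> 'cV[R]_m -> R).

Lemma supconv_ge_self x y : supconv f a b B h -> nrm x <= a -> nrm y <= b ->
  f x y <= h x y.
Proof.
move=> sc xa yb; have := supconv_ge sc x yb xa.
by rewrite /penal subrr sqnorm0 mulr0 subr0.
Qed.

Lemma argmin_exists : saddle f a b K eps M -> supconv f a b B h ->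
  exists ym, argmin_of h b ym.
Proof.
move=> sd sc.
have /choice[ym ymP] (x : 'cV[R]_n) : exists y, nrm y <= b /\
    forall w, nrm w <= b -> h x y <= h x w.
  have [||||y yb H] := @usc_max R m [set v | nrm v <= b] (fun v => - h x v) b.
  - by exists 0; rewrite /= nrm0 ltW // (saddle_b sd).
  - by [].
  - by apply: closed_nrm_le; [exact: ltW (saddle_b sd)|exact: vcont_id].
  - move=> v vb e e0; have [x' xa hE] := supconv_att sc x vb.
    have [d d0 fd] := saddle_cont sd xa vb e0.
    exists d => // w /= wb wv; have := supconv_ge sc x wb xa.
    have := fd x' w xa wb; rewrite subrr nrm0 => /(_ d0 wv).
    by rewrite ltr_norml hE /penal => /andP[]; lra.
  - by exists y; split=> // w wb; have := H w wb; rewrite lerN2.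
by exists ym; split=> x; [exact: (ymP x).1|exact: (ymP x).2].
Qed.

(** The midpoint of the two maximisers competes at the midpoint. Its defect K |x1' - x2'|^2 is split
    into a part from x1 - x2 and a part from the change of x - x'; the penalty pays for the latter,
    as [4 * K <= B]. *)
Lemma supconv_semi x1 x2 y1 y2 : saddle f a b K eps M -> supconv f a b B h ->
  4 * K <= B -> nrm y1 <= b -> nrm y2 <= b ->
  h x1 y1 + h x2 y2 <= 2 * h (mid x1 x2) (mid y1 y2)
      + 2 * K * sqnorm (x1 - x2) + K * sqnorm (y1 - y2).
Proof.
move=> sd sc BK yb1 yb2.
have [x1' xa1 ->] := supconv_att sc x1 yb1.
have [x2' xa2 ->] := supconv_att sc x2 yb2.
have := supconv_ge sc (mid x1 x2) (nrm_mid yb1 yb2) (nrm_mid xa1 xa2).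
have := saddle_semi sd xa1 xa2 yb1 yb2; rewrite /penal.
have -> : mid x1 x2 - mid x1' x2' = mid (x1 - x1') (x2 - x2').
  by rewrite /mid -scalerBr opprD addrACA.
have := sqnorm_mid (x1 - x1') (x2 - x2').
have -> : x1 - x1' - (x2 - x2') = (x1 - x2) - (x1' - x2').
  by apply/colP => i; rewrite !mxE; ring.
set u := x1 - x2; set v := x1' - x2'.
have h1 : sqnorm v <= 2 * sqnorm u + 2 * sqnorm (u - v).
  have := sqnorm_ge0 (2 *: u - v); rewrite (sqnormB (2 *: u)) (sqnormB u v) sqnormZ dotvZl; lra.
have K0 := saddle_K sd.
have h2 := ler_wpM2l (ltW K0) h1.
have h3 : 4 * K * sqnorm (u - v) <= B * sqnorm (u - v) by rewrite ler_wpM2r ?sqnorm_ge0.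
move=> h4 h5 h6.
have h7 : 2 * (B * sqnorm (mid (x1 - x1') (x2 - x2'))) = B * sqnorm (x1 - x1')
    + B * sqnorm (x2 - x2') - B * sqnorm (u - v) / 2.
  by rewrite mulrCA h4; field.
lra.
Qed.

(** The maximiser for the midpoint competes at both ends. *)
Lemma supconv_conv x y1 y2 : saddle f a b K eps M -> supconv f a b B h ->
  nrm y1 <= b -> nrm y2 <= b ->
  2 * h x (mid y1 y2) <= h x y1 + h x y2 - eps / 2 * sqnorm (y1 - y2).
Proof.
move=> sd sc yb1 yb2.
have [x' xa ->] := supconv_att sc x (nrm_mid yb1 yb2).
have := supconv_ge sc x yb1 xa; have := supconv_ge sc x yb2 xa.
have := saddle_conv sd xa yb1 yb2 half01; rewrite -midE /penal; lra.
Qed.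

(** The penalty contributes a midpoint gain B / 2 >= 2 K against the loss K of [f]; what remains
    makes maximisers unique. *)
Lemma penal_concave x x1 x2 y : saddle f a b K eps M -> 4 * K <= B ->
  nrm y <= b -> nrm x1 <= a -> nrm x2 <= a ->
  penal f B x x1 y + penal f B x x2 y <=
    2 * penal f B x (mid x1 x2) y - K * sqnorm (x1 - x2).
Proof.
move=> sd BK yb xa1 xa2; have := saddle_semi sd xa1 xa2 yb yb.
rewrite subrr sqnorm0 addr0.
have -> : mid y y = y by rewrite midE -scalerDl subrK scale1r.
rewrite /penal; have -> : x - mid x1 x2 = mid (x - x1) (x - x2).
  by rewrite midE; apply/colP => i; rewrite !mxE; field.
have := sqnorm_mid (x - x1) (x - x2).
have -> : x - x1 - (x - x2) = - (x1 - x2).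
  by apply/colP => i; rewrite !mxE; ring.
rewrite sqnormN => h4.
have h7 : 2 * (B * sqnorm (mid (x - x1) (x - x2))) = B * sqnorm (x - x1)
    + B * sqnorm (x - x2) - B * sqnorm (x1 - x2) / 2.
  by rewrite mulrCA h4; field.
have := ler_wpM2r (sqnorm_ge0 (x1 - x2)) BK; lra.
Qed.

(* Minimax: the maximiser for the minimising [y] is a saddle point.  It is the
   limit of the maximisers for nearby points of the segment from [ym x] to [y],
   because maximisers are unique by strict concavity. *)
Lemma supconv_minimax ym x : saddle f a b K eps M -> supconv f a b B h ->
  argmin_of h b ym -> 4 * K <= B ->
  exists2 x0, nrm x0 <= a & forall y, nrm y <= b -> h x (ym x) <= penal f B x x0 y.
Proof.
move=> sd sc am BK; set g := h x (ym x); have K0 := saddle_K sd.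
have ymb := argmin_in am x.
have [x0 xa0 gE] := supconv_att sc x ymb; exists x0 => // y yb.
pose t (j : nat) : R := j.+1%:R^-1.
have t0 j : 0 < t j by rewrite /t invr_gt0.
have t1 j : t j <= 1 by rewrite /t invf_le1 ?ler1n.
have t01 j : 0 <= t j <= 1 by rewrite t1 ltW.
pose yt j := (1 - t j) *: ym x + t j *: y.
have ytb j : nrm (yt j) <= b.
  rewrite -[X in nrm X]subr0; apply: conv_in_ball => //; by rewrite subr0.
have /choice[xs xsP] j : exists x', nrm x' <= a /\ h x (yt j) = penal f B x x' (yt j).
  by have [x' ? ?] := supconv_att sc x (ytb j); exists x'.
have gxs j : g <= (1 - t j) * penal f B x (xs j) (ym x) + t j * penal f B x (xs j) y.
  have [xa hE] := xsP j; apply: le_trans (argmin_le am x (ytb j)) _; rewrite hE.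
  have := saddle_conv sd xa ymb yb (t01 j); rewrite /penal -/(yt j).
  have : 0 <= eps * (t j * (1 - t j)) * sqnorm (ym x - y).
    by rewrite !mulr_ge0 ?subr_ge0 ?(ltW (t0 j)) ?(ltW (saddle_eps sd)) ?sqnorm_ge0.
  lra.
have xle j : penal f B x (xs j) (ym x) <= g := supconv_ge sc x ymb (xsP j).1.
(* The convex combination in [gxs] is at least [g] while its part at [ym x] is at most [g]; hence
   the part at [y] is at least [g]. *)
have gy j : g <= penal f B x (xs j) y.
  have := gxs j; have := xle j; have := t1 j; have := t0 j; nra.
have gym j : g - 2 * M * t j <= penal f B x (xs j) (ym x).
  have := gxs j; have := saddle_bd sd (xsP j).1 yb.
  have := saddle_bd sd (xsP j).1 ymb; rewrite /penal !ler_norml.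
  move=> /andP[k1 k2] /andP[k3 k4] k5.
  have k6 : t j * (f (xs j) y - f (xs j) (ym x)) <= t j * (2 * M).
    by rewrite ler_wpM2l ?(ltW (t0 j)) //; lra.
  lra.
have [v cv] := ball_cluster (fun j => (xsP j).1).
have va : nrm v <= a.
  apply: (@closed_nrm_le R n n id a (ltW (saddle_a sd)) (@vcont_id R n) v) => e e0.
  by have [j _ ?] := cv e e0 0%N; exists (xs j) => //=; exact: (xsP j).1.
have M0 : 0 <= M.
  by apply: le_trans (saddle_bd sd xa0 yb).
have gv : g <= penal f B x v y.
  apply/ler_addgt0Pr => e e0; have [d d0 ud] := penal_usc B x sd yb va e0.
  have [j _ jd] := cv d d0 0%N; have := ud _ (xsP j).1 jd; have := gy j; lra.
have gvm : g <= penal f B x v (ym x).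
  apply/ler_addgt0Pr => e e0; have e2 : 0 < e / 2 by rewrite divr_gt0.
  have [d d0 ud] := penal_usc B x sd ymb va e2.
  have e3 : 0 < e / 2 / (2 * M + 1) by rewrite divr_gt0 //; lra.
  have [N NP] := nat_inv_lt e3; have [j Nj jd] := cv d d0 N.
  have := ud _ (xsP j).1 jd; have := gym j; have := NP j Nj; rewrite -/(t j).
  rewrite ltr_pdivlMr; last by lra.
  have := t0 j; lra.
(* Both [x0] and [v] attain [g] at [ym x]; were they distinct, strict concavity would lift their
   midpoint above [g]. *)
have /eqP : sqnorm (x0 - v) = 0.
  have := penal_concave x sd BK ymb xa0 va.
  have := supconv_ge sc x ymb (nrm_mid xa0 va); rewrite -/g in gE * => k1 k2.
  apply/eqP; rewrite eq_le sqnorm_ge0 andbT -(ler_pM2l K0) mulr0; lra.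
by rewrite sqnorm_eq0 subr_eq0 => /eqP ->.
Qed.

(** With the saddle point [x0] frozen, the penalties at z and at x differ by a quadratic in z that
    does not involve y. *)
Lemma supconv_supported ym : saddle f a b K eps M -> supconv f a b B h ->
  argmin_of h b ym -> 4 * K <= B -> parab_supported (fun x => h x (ym x)) (2 * B).
Proof.
move=> sd sc am BK x; have [x0 xa0 P] := supconv_minimax x sd sc am BK.
exists (2 * B *: (x0 - x)) => z.
have := P _ (argmin_in am z); have := supconv_ge sc z (argmin_in am z) xa0.
rewrite /penal.
have -> : z - x0 = (z - x) - (x0 - x) by rewrite opprB addrA subrK.
rewrite sqnormB dotvZl (dotvC (x0 - x)).
have -> : x - x0 = - (x0 - x) by rewrite opprB.
rewrite sqnormN.
lra.
Qed.

Lemma supconv_growth ym x y : saddle f a b K eps M -> supconv f a b B h ->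
  argmin_of h b ym -> nrm y <= b ->
  h x (ym x) + eps / 2 * sqnorm (y - ym x) <= h x y.
Proof.
move=> sd sc am yb; have := supconv_conv x sd sc yb (argmin_in am x).
have := argmin_le am x (nrm_mid yb (argmin_in am x)); lra.
Qed.

(** Freezing y at [ym v] gives a function semiconcave in x that touches the semiconvex marginal from
    above at v. Their gap at v + w is thus O(|w|^2), and quadratic growth in y turns it into a
    distance between minimisers. *)
Lemma argmin_lip ym : saddle f a b K eps M -> supconv f a b B h ->
  argmin_of h b ym -> 4 * K <= B ->
  exists2 L : R, 0 <= L & forall u v, nrm (ym u - ym v) <= L * nrm (u - v).
Proof.
move=> sd sc am BK; have K0 := saddle_K sd; have e0 := saddle_eps sd.
have q0 : 0 <= 2 / eps * (8 * K + 2 * B).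
  by rewrite mulr_ge0 ?divr_ge0 ?(ltW e0) //; lra.
exists (Num.sqrt (2 / eps * (8 * K + 2 * B))) => [|u v]; first exact: sqrtr_ge0.
rewrite le_nrm ?mulr_ge0 ?sqrtr_ge0 // exprMn sqr_sqrtr // sqr_nrm.
have [w ->] : exists w, u = v + w by exists (u - v); rewrite addrC subrK.
rewrite [v + w - v]addrC addKr.
have [p P] := supconv_supported sd sc am BK v.
have := P (v + w); have := P (v - w).
rewrite ![v + _ - v]addrC !addKr dotvNr sqnormN => h1 h2.
have := supconv_semi (v + w) (v - w) sd sc BK (argmin_in am v) (argmin_in am v).
have -> : mid (ym v) (ym v) = ym v by rewrite midE -scalerDl subrK scale1r.
have -> : mid (v + w) (v - w) = v.
  by rewrite midE; apply/colP => i; rewrite !mxE; field.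
have -> : v + w - (v - w) = 2 *: w by apply/colP => i; rewrite !mxE; ring.
rewrite subrr sqnorm0 mulr0 addr0 sqnormZ => h3.
have h4 := argmin_le am (v - w) (argmin_in am v).
have := supconv_growth (v + w) sd sc am (argmin_in am v).
rewrite -(opprB (ym v)) sqnormN => h5.
have : eps / 2 * sqnorm (ym v - ym (v + w)) <= (8 * K + 2 * B) * sqnorm w by lra.
move=> h6; have -> : sqnorm (ym v - ym (v + w)) =
    2 / eps * (eps / 2 * sqnorm (ym v - ym (v + w))) by field; lra.
have q1 : 0 <= 2 / eps by rewrite divr_ge0 // ltW.
by apply: le_trans (ler_wpM2l q1 h6) _; rewrite mulrA.
Qed.

(** Semiconcavity between the reflected points [ym x + w] and [ym x - w]; the second is no lower
    than the minimum. *)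
Lemma supconv_upper ym x w : saddle f a b K eps M -> supconv f a b B h ->
  argmin_of h b ym -> 4 * K <= B -> nrm (ym x + w) <= b -> nrm (ym x - w) <= b ->
  h x (ym x + w) <= h x (ym x) + 4 * K * sqnorm w.
Proof.
move=> sd sc am BK wb1 wb2; have := supconv_semi x x sd sc BK wb1 wb2.
have -> : mid x x = x by rewrite midE -scalerDl subrK scale1r.
have -> : mid (ym x + w) (ym x - w) = ym x.
  by rewrite midE; apply/colP => i; rewrite !mxE; field.
have -> : ym x + w - (ym x - w) = 2 *: w by apply/colP => i; rewrite !mxE; ring.
rewrite subrr sqnorm0 mulr0 addr0 sqnormZ.
have := argmin_le am x wb2; lra.
Qed.

Lemma argmin_le0 ym x : saddle f a b K eps M -> supconv f a b B h ->
  argmin_of h b ym -> 4 * K <= B -> h x (ym x) <= 0.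
Proof.
move=> sd sc am BK; have [x0 xa0 P] := supconv_minimax x sd sc am BK.
apply/ler_addgt0Pr => e /(saddle_le sd xa0)[y yb fy]; rewrite add0r.
apply: le_trans (P y yb) _; rewrite /penal; have := sqnorm_ge0 (x - x0).
have := saddle_K sd; nra.
Qed.

Lemma argmin_0 ym : saddle f a b K eps M -> supconv f a b B h ->
  argmin_of h b ym -> 4 * K <= B -> ym 0 = 0 /\ h 0 (ym 0) = 0.
Proof.
move=> sd sc am BK; have e0 := saddle_eps sd.
have a0 := ltW (saddle_a sd); have b0 := ltW (saddle_b sd).
have n0 k : nrm (0 : 'cV[R]_k) <= a /\ nrm (0 : 'cV[R]_k) <= b by rewrite nrm0.
have yb := argmin_in am 0.
have h1 := supconv_ge_self sc (n0 n).1 yb.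
have h2 := argmin_le0 0 sd sc am BK.
have h3 := saddle_conv sd (n0 n).1 yb (n0 m).2 half01.
have h4 := saddle_ge sd (nrm_mid yb (n0 m).2).
rewrite -midE (saddle_00 sd) subr0 in h3.
have h5 := saddle_ge sd yb.
have : sqnorm (ym 0) <= 0 by rewrite -(ler_pM2l e0) mulr0; lra.
move=> h6; split; last lra.
by apply/eqP; rewrite -sqnorm_eq0 eq_le h6 sqnorm_ge0.
Qed.

End FixedSaddle.

(** The [N] term measures distance from the graph of an affine map of slope [G], so the pullback of
    the Hessian along [G] is exactly [A]. *)
Definition mixed_contact n m (f : 'cV[R]_n -> 'cV[R]_m -> R) x1 y1 A :=
  exists (d N : R) p q (G : 'M[R]_(m, n)), 0 < d /\
    forall x y, nrm (x - x1) < d -> nrm (y - y1) < d ->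
    f x y <= f x1 y1 + dotv p (x - x1) + dotv q (y - y1)
      + 2^-1 * qform A (x - x1) + N * sqnorm (y - y1 - G *m (x - x1)).

Lemma mulmx_bounded n m (G : 'M[R]_(m, n)) :
  exists2 C : R, 0 <= C & forall u, nrm (G *m u) <= C * nrm u.
Proof.
have q0 : 0 <= \sum_i sqnorm (row i G)^T by apply: sumr_ge0 => i _; exact: sqnorm_ge0.
exists (Num.sqrt (\sum_i sqnorm (row i G)^T)) => [|u]; first exact: sqrtr_ge0.
rewrite le_nrm ?mulr_ge0 ?sqrtr_ge0 // exprMn sqr_sqrtr // sqr_nrm mulr_suml.
apply: ler_sum => i _; have -> : (G *m u) i 0 = dotv (row i G)^T u.
  by rewrite dotvE mxE; apply: eq_bigr => j _; rewrite !mxE.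
exact: CauchySchwarz.
Qed.

Lemma dotv_trmx n m (G : 'M[R]_(m, n)) u v : dotv (G^T *m v) u = dotv v (G *m u).
Proof. by rewrite /dotv trmx_mul trmxK mulmxA. Qed.

(* The maximum is taken jointly over [x], [x'] and [y]; at the maximum point
   the shift [x - x'] is frozen, which turns a test function for the
   sup-convolution into one for [f]. *)
Lemma mixed_contact_of_max n m (f : 'cV[R]_n -> 'cV[R]_m -> R) a b K eps M B
    (c : 'cV[R]_n) y0 r p A (G : 'M[R]_(m, n)) N :
  saddle f a b K eps M -> 0 <= r -> Defs.symmetric A ->
  let phi x y := dotv p (x - c) + 2^-1 * qform A (x - c)
    + N * sqnorm (y - y0 - G *m (x - c)) in
  let C := [set z : 'cV[R]_n * 'cV[R]_n * 'cV[R]_m |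
    [/\ nrm (z.1.1 - c) <= r, nrm z.1.2 <= a, nrm z.2 <= b &
        nrm (z.2 - y0 - G *m (z.1.1 - c)) <= r]] in
  let T z := penal f B z.1.1 z.1.2 z.2 - phi z.1.1 z.2 in
  C !=set0 ->
  exists2 z, C z & (forall w, C w -> T w <= T z) /\
    (nrm (z.1.1 - c) < r -> nrm z.1.2 < a -> nrm z.2 < b ->
     nrm (z.2 - y0 - G *m (z.1.1 - c)) < r -> mixed_contact f z.1.2 z.2 A).
Proof.
move=> sd r0 sA phi C T [[[xx xx'] yy] Cxy].
have a0 := ltW (saddle_a sd); have b0 := ltW (saddle_b sd).
(* The triple is stacked into one column so that [usc_max] applies. *)
pose X (z : 'cV[R]_(n + (n + m))) := usubmx z.
pose X' (z : 'cV[R]_(n + (n + m))) := usubmx (dsubmx z).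
pose Y (z : 'cV[R]_(n + (n + m))) := dsubmx (dsubmx z).
have cX : vcont X by exact: vcont_usub.
have cX' : vcont X'.
  move=> i w e e0; have [d d0 h] := cont_coord (rshift n (lshift m i)) w e0.
  by exists d => // z /h; rewrite !mxE.
have cY : vcont Y.
  move=> i w e e0; have [d d0 h] := cont_coord (rshift n (rshift n i)) w e0.
  by exists d => // z /h; rewrite !mxE.
have cXc : vcont (fun z => X z - c) := vcontB cX (@vcont_cst R _ _ c).
have cl : vcont (fun z => Y z - y0 - G *m (X z - c)).
  by apply: vcontB (vcont_mulmx _ cXc); apply: vcontB cY _; exact: vcont_cst.
pose D := [set z | nrm (X z - c) <= r] `&` ([set z | nrm (X' z) <= a] `&`
  ([set z | nrm (Y z) <= b] `&` [set z | nrm (Y z - y0 - G *m (X z - c)) <= r])).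
pose U z := (X z, X' z, Y z).
have DC z : D z <-> C (U z) by split=> [[? [? [? ?]]]|[]].
have colE x x' y : U (col_mx x (col_mx x' y)) = (x, x', y).
  by rewrite /U /X /X' /Y !col_mxKd !col_mxKu.
have [||||z Dz zmax] := @usc_max R _ D (fun z => T (U z)) (nrm c + r + (a + b)).
- by exists (col_mx xx (col_mx xx' yy)); apply/DC; rewrite colE.
- move=> z [/= h1 [/= h2 [/= h3 _]]].
  rewrite -(vsubmxK z) -(vsubmxK (dsubmx z)).
  apply: le_trans (nrm_col_mx _ _) _; apply: lerD.
    have := nrmD (X z - c) c; rewrite subrK /X; lra.
  by apply: le_trans (nrm_col_mx _ _) _; exact: lerD.
- by apply: closedI; [|apply: closedI; [|apply: closedI]]; exact: closed_nrm_le.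
- move=> z [/= h1 [/= h2 [/= h3 _]]]; apply: usc_atD; last first.
    move=> w e e0; pose ph z := dotv p (X z - c) + 2^-1 * qform A (X z - c)
      + N * sqnorm (Y z - y0 - G *m (X z - c)).
    have cph : cont ph.
      apply: contD; last by apply: cont_scale; exact: cont_sqnorm.
      apply: contD; first by apply: cont_dotv => //; exact: vcont_cst.
      by apply: cont_scale; exact: cont_qform.
    have [d d0 hd] := cont_scale (-1) cph w e0.
    by exists d => // v /hd; rewrite !mulN1r.
  apply: usc_atD.
    move=> e /(saddle_cont sd h2 h3)[d d0 hd].
    exists d => // w [/= k1 [/= k2 [/= k3 _]]] wz.
    have := hd (X' w) (Y w) k2 k3; rewrite ltr_norml => H.
    have hz : w - z = col_mx (X w - X z) (col_mx (X' w - X' z) (Y w - Y z)).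
      rewrite -{1}(vsubmxK w) -{1}(vsubmxK z) opp_col_mx add_col_mx.
      rewrite -{1}(vsubmxK (dsubmx w)) -{1}(vsubmxK (dsubmx z)).
      by rewrite opp_col_mx add_col_mx.
    have t1 : nrm (X' w - X' z) < d.
      apply: le_lt_trans wz; rewrite hz; apply: le_trans (nrm_col_mxr _ _).
      exact: nrm_col_mxl.
    have t2 : nrm (Y w - Y z) < d.
      apply: le_lt_trans wz; rewrite hz; apply: le_trans (nrm_col_mxr _ _).
      exact: nrm_col_mxr.
    by have /andP[_] := H t1 t2; rewrite /=; lra.
  move=> w e e0.
  have [d d0 hd] := cont_scale (- B) (cont_sqnorm (vcontB cX cX')) w e0.
  by exists d => // v /hd; rewrite !mulNr.
exists (U z); first exact/DC.
split=> [w Cw|].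
  have := zmax (col_mx w.1.1 (col_mx w.1.2 w.2)).
  by rewrite colE -!surjective_pairing; apply; apply/DC; rewrite colE -!surjective_pairing.
rewrite /U /=; set x1 := X z; set x' := X' z; set y1 := Y z => k1 k2 k3 k4.
set l1 := y1 - y0 - G *m (x1 - c) in k4.
have [Cg Cg0 CgP] := mulmx_bounded G.
(* Room to move [x1] and [x'] by one common vector and [y1] by another inside [C]; [Cg + 1] allows
   for the tilt by [G]. *)
pose d := Num.min (Num.min (r - nrm (x1 - c)) (a - nrm x'))
  (Num.min (b - nrm y1) ((r - nrm l1) / (Cg + 1))).
have Cg1 : 0 < Cg + 1 by lra.
have d0 : 0 < d by rewrite /d !lt_min !subr_gt0 k1 k2 k3 /= divr_gt0 // subr_gt0.
exists d, N, (p + A *m (x1 - c) - 2 * N *: (G^T *m l1)), (2 * N *: l1), G.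
split=> // x y; set u := x - x'; set v := y - y1; rewrite /d !lt_min.
move=> /andP[/andP[u1 u2] /andP[_ u4]] /andP[_ /andP[v3 v4]].
have xE : x = x' + u by rewrite addrC subrK.
have yE : y = y1 + v by rewrite addrC subrK.
have Cw : D (col_mx (x1 + u) (col_mx x y)).
  apply/DC; rewrite colE /C /=; split.
  - rewrite addrAC; apply: le_trans (nrmD _ _) _; lra.
  - rewrite xE; apply: le_trans (nrmD _ _) _; lra.
  - rewrite yE; apply: le_trans (nrmD _ _) _; lra.
  - have -> : y - y0 - G *m (x1 + u - c) = l1 + (v - G *m u).
      rewrite yE (addrAC x1) mulmxDr /l1; apply/colP => i; rewrite !mxE; ring.
    apply: le_trans (nrmD _ _) _; have := nrmB v (G *m u); have := CgP u.
    move: u4 v4; rewrite !ltr_pdivlMr //.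
    have := nrm_ge0 u; have := nrm_ge0 v; nra.
have := zmax _ Cw; rewrite colE /T /U /= /penal /phi -/x1 -/x' -/y1 -/l1.
have -> : x1 + u - x = x1 - x' by rewrite xE; apply/colP => i; rewrite !mxE; ring.
have -> : y - y0 - G *m (x1 + u - c) = l1 + (v - G *m u).
  rewrite yE (addrAC x1) mulmxDr /l1; apply/colP => i; rewrite !mxE; ring.
have -> : x1 + u - c = (x1 - c) + u by rewrite addrAC.
rewrite qformD // (sqnormD l1) (dotvDr l1) (dotvNr l1) -dotv_trmx.
rewrite !(dotvDl u) (dotvNl u) !dotvZl (dotvDr p); lra.
Qed.

End SupConvolution.

(** * Contact points of a saddle with almost nonpositive Hessian *)

Section SaddleContact.
Variable R : realType.

(* Compare the maximiser [x'] with the competitor [x1] itself. *)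
Lemma penal_max_near n m (f : 'cV[R]_n -> 'cV[R]_m -> R) (B a M : R) x1 x' y :
  0 < B -> 0 <= a -> 32 * M <= B * a ^+ 2 -> `|f x1 y| <= M -> `|f x' y| <= M ->
  penal f B x1 x1 y <= penal f B x1 x' y -> nrm (x1 - x') <= a / 4.
Proof.
move=> B0 a0 Ba; rewrite !ler_norml => /andP[f1 f2] /andP[f3 f4].
rewrite /penal subrr sqnorm0 mulr0 subr0 => h; rewrite le_nrm; last lra.
rewrite -(ler_pM2l B0); lra.
Qed.

(** Splits one weighted bound into strict bounds on its two squared distances, which puts the
    maximum point in the interior. *)
Lemma lt_of_weighted (al mn r u w : R) : 0 < mn -> mn <= al -> 0 < r -> 0 <= w ->
  al * u + w <= mn / 2 * r -> u < r.
Proof.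
move=> mn0 mnal r0 w0 h; rewrite ltNge; apply/negP => ru.
have al0 : 0 <= al by lra.
have := ler_wpM2l al0 ru; have := ler_wpM2r (ltW r0) mnal.
have := mulr_gt0 mn0 r0; lra.
Qed.

Lemma saddle_mixed_contact n m (f : 'cV[R]_n -> 'cV[R]_m -> R) a b K eps M (s : R) :
  saddle f a b K eps M -> 0 < s ->
  exists x1 y1 A, [/\ nrm x1 < a, nrm y1 < b, Defs.symmetric A, qform_le A s &
    mixed_contact f x1 y1 A].
Proof.
move=> sd s0; have K0 := saddle_K sd; have a0 := saddle_a sd; have b0 := saddle_b sd.
have M0 : 0 <= M.
  have := saddle_bd sd (x := 0) (y := 0); rewrite !nrm0 => /(_ (ltW a0) (ltW b0)).
  by apply: le_trans.
(* The first term serves the sup-convolution lemmas, the second keeps maximisers [x'] within a / 4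
   of [x1]. *)
pose B := 4 * K + 32 * (M + 1) / a ^+ 2.
have a2 : 0 < a ^+ 2 by rewrite exprn_gt0.
have Bq : 0 < 32 * (M + 1) / a ^+ 2 by rewrite divr_gt0 //; lra.
have BK : 4 * K <= B by rewrite /B; lra.
have Ba : 32 * (M + 1) <= B * a ^+ 2.
  have -> : B * a ^+ 2 = 4 * K * a ^+ 2 + 32 * (M + 1) by rewrite /B; field; lra.
  have := mulr_gt0 K0 a2; lra.
have B0 : 0 < B by lra.
have BaM : 32 * M <= B * a ^+ 2 by lra.
clear Bq Ba a2 M0.
have [h sc] := supconv_exists B sd.
have [ym am] := argmin_exists sd sc.
have [L L0 yL] := argmin_lip sd sc am BK.
have [ym0 g0] := argmin_0 sd sc am BK.
have gL := supconv_supported sd sc am BK.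
pose g x := h x (ym x).
(* Keeps the minimisers over the a'-ball within b / 4 of 0, with room for displacements up to 2
   r. *)
pose a' := Num.min (a / 4) (b / (8 * (L + 1))).
have L8 : 0 < 8 * (L + 1) by lra.
have a'0 : 0 < a' by rewrite /a' lt_min !divr_gt0.
have a'a : a' <= a / 4 by rewrite /a' ge_min lexx.
have a'b : a' * (8 * (L + 1)) <= b.
  by rewrite -ler_pdivlMr // /a' ge_min lexx orbT.
have s2 : 0 < s / 2 by lra.
pose mn := Num.min (4 * K) (s / 4).
have mn0 : 0 < mn by rewrite /mn lt_min !divr_gt0 ?mulr_gt0.
have mnK : mn <= 4 * K by rewrite /mn ge_min lexx.
have mns : mn <= s / 4 by rewrite /mn ge_min lexx orbT.
have q0 : 0 < 2 * (1 + 8 * K) by lra.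
pose th := mn / (2 * (1 + 8 * K)).
have th0 : 0 < th by rewrite /th divr_gt0.
have thE : th * (1 + 8 * K) = mn / 2 by rewrite /th; field; lra.
have th1 : th <= 1 by rewrite /th ler_pdivrMr // mul1r; lra.
have B2 : 0 < 2 * B by rewrite mulr_gt0.
have [||c [r [p [A [G [r0 cr sA As H]]]]]] := near_quadratic_near_affine (y := ym)
  B2 L0 a'0 s2 th0 gL g0.
- by move=> x _; exact: argmin_le0 sd sc am BK.
- by move=> u v _ _; exact: yL.
have ymb x : nrm x <= a' -> nrm (ym x) <= b / 4.
  move=> xa; have := yL x 0; rewrite ym0 !subr0; nra.
have nc := nrm_ge0 c.
have rb : 8 * r <= b by nra.
pose A' := A + (s / 2)%:M.
have sA' : Defs.symmetric A' by rewrite /Defs.symmetric linearD /= sA tr_scalar_mx.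
have A's : qform_le A' s.
  by move=> v; rewrite qformDl qform_scal; have := As v; lra.
have ymc : nrm (ym c) <= b / 4 by apply: ymb; lra.
have ymcb : nrm (ym c) <= b by lra.
have [xc xca gc] := supconv_att sc c ymcb.
(* The weight is 3 times 4 K: growth 4 K |e1 - e2|^2 of [h] costs up to 8 K |e1|^2, leaving 4 K
   |e1|^2. Likewise the s / 2 added to [A] leaves s / 4 |v|^2. Both leftovers are bounded by the
   th-errors, too small for the boundary. *)
have [|[[x1 x'] y1] /= [k1 k2 k3 k4] [zmax fin]] := @mixed_contact_of_max R n m f a b K
  eps M B c (ym c) r p A' G (3 * (4 * K)) sd (ltW r0) sA'.
  by exists (c, xc, ym c); rewrite /= !subrr mulmx0 sub0r oppr0 !nrm0 ltW.
exists x', y1, A'.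
clear L0 yL ym0 g0 gL L8 a'0 a'b q0 th0 B2 As ymc.
clearbody a' B mn th.
set e1 := y1 - ym c - G *m (x1 - c) in k4 fin zmax *.
pose v := x1 - c; have xE : x1 = c + v by rewrite addrC subrK.
have vr : nrm v <= r by [].
have [H1 H2] := H v vr.
set e2 := ym (c + v) - ym c - G *m v in H1.
have r2 : 0 < r ^+ 2 by rewrite exprn_gt0.
have e2r : nrm e2 <= r.
  by rewrite le_nrm ?(ltW r0) //; apply: le_trans H1 _; rewrite ler_piMl // ltW.
have wE : y1 = ym x1 + (e1 - e2).
  by rewrite xE /e1 /e2 -/v; apply/colP => i; rewrite !mxE; ring.
have x1a : nrm x1 <= a'.
  by rewrite xE; apply: le_trans (nrmD _ _) _; clear -vr cr; lra.
have ymx := ymb x1 x1a.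
have w2 := nrmB e1 e2.
have y1b : nrm y1 < b.
  by rewrite wE; apply: le_lt_trans (nrmD _ _) _; clear -ymx w2 k4 e2r rb r0; lra.
have hy : h x1 y1 <= g x1 + 4 * K * sqnorm (e1 - e2).
  rewrite {1}wE; apply: (supconv_upper sd sc am BK).
    by apply: le_trans (nrmD _ _) _; clear -ymx w2 k4 e2r rb r0; lra.
  by apply: le_trans (nrmB _ _) _; clear -ymx w2 k4 e2r rb r0; lra.
have ew : sqnorm (e1 - e2) <= 2 * sqnorm e1 + 2 * sqnorm e2.
  by have := sqnorm_ge0 (e1 + e2); rewrite (sqnormD e1) (sqnormB e1);
    clear; lra.
have := zmax (c, xc, ym c); rewrite /= !subrr mulmx0 subr0 !nrm0.
move=> /(_ (And4 (ltW r0) xca ymcb (ltW r0))).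
rewrite dotv0r qform0 sqnorm0 !mulr0 !addr0 subr0 -gc -/v.
have hp := supconv_ge sc x1 k3 k2.
rewrite /A' qformDl qform_scal => key.
have K4 : 0 < 4 * K by rewrite mulr_gt0.
have bnd : s / 4 * sqnorm v + 4 * K * sqnorm e1 <= mn / 2 * r ^+ 2.
  have t1 := ler_wpM2l (ltW K4) ew; have t2 := ler_wpM2l (ltW K4) H1.
  rewrite -thE; move: H2; rewrite -/(g c) -xE -/(g x1) => H2.
  rewrite -/(g c) in key; clear -key H2 t1 t2 hy hp; lra.
have vr' : nrm v < r.
  rewrite lt_nrm ?(ltW r0) //.
  exact: (lt_of_weighted mn0 mns r2 (mulr_ge0 (ltW K4) (sqnorm_ge0 e1)) bnd).
have er' : nrm e1 < r.
  rewrite lt_nrm ?(ltW r0) //; rewrite addrC in bnd.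
  have s4 : 0 <= s / 4 by rewrite divr_ge0 // ltW.
  exact: (lt_of_weighted mn0 mnK r2 (mulr_ge0 s4 (sqnorm_ge0 v)) bnd).
have x1a4 : nrm x1 <= a / 4 by exact: le_trans x1a a'a.
have x'a : nrm x' < a.
  have x1a' : nrm x1 <= a by apply: le_trans x1a4 _; clear -a0; lra.
  have := zmax (x1, x1, y1); rewrite /= -/v -/e1 lerD2r => /(_ (And4 k1 x1a' k3 k4)).
  move=> /(penal_max_near B0 (ltW a0) BaM (saddle_bd sd x1a' k3) (saddle_bd sd k2 k3)) h4.
  rewrite -(subrK x1 x'); apply: le_lt_trans (nrmD _ _) _; rewrite (nrmBC x').
  by clear -h4 x1a4 a0; lra.
by split=> //; exact: fin.
Qed.

End SaddleContact.

(** * Marginals of subharmonic functions *)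

Section MarginalSubharmonic.
Variable R : realType.

Lemma qform_block n m (A : 'M[R]_n) (B : 'M[R]_(n, m)) (C : 'M[R]_(m, n))
    (D : 'M[R]_m) u v :
  qform (block_mx A B C D) (col_mx u v) =
  qform A u + dotv u (B *m v) + dotv v (C *m u) + qform D v.
Proof.
by rewrite qformE mul_block_col dotv_col_mx !dotvDr -!qformE; ring.
Qed.

Lemma semiconcave_conv k (U : set 'cV[R]_k) ka h a b t :
  semiconcave_on U ka h -> U a -> U b -> 0 <= t <= 1 ->
  (1 - t) * h a + t * h b - ka / 2 * (t * (1 - t)) * sqnorm (a - b) <=
    h ((1 - t) *: a + t *: b).
Proof.
move=> sc Ua Ub t01; have := sc a b t Ua Ub t01.
rewrite sqnorm_conv; lra.
Qed.

(* A nearby point [w] is a convex combination of [z] and a point at fixed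
   distance, where [h] is bounded below. *)
Lemma semiconcave_lsc k (D : set 'cV[R]_k) h : locally_semiconcave D h ->
  bounded_below_on D h -> forall z, D z -> forall e : R, 0 < e ->
  exists2 d : R, 0 < d & forall w, nrm (w - z) < d -> D w /\ h z - e < h w.
Proof.
move=> sc [M hM] z Dz e e0; have [r [ka [r0 ka0 rD rsc]]] := sc z Dz.
pose Q := h z - M + ka * r ^+ 2 + 1.
have Mz := hM z Dz.
have Q0 : 0 < Q by have := mulr_ge0 ka0 (sqr_ge0 r); rewrite /Q; lra.
pose t0 := Num.min 1 (e / Q).
have t00 : 0 < t0 by rewrite /t0 lt_min ltr01 divr_gt0.
have t01 : t0 <= 1 by rewrite /t0 ge_min lexx.
have t0Q : t0 * Q <= e by rewrite -ler_pdivlMr // /t0 ge_min lexx orbT.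
exists (t0 * (r / 2)) => [|w wz]; first by rewrite mulr_gt0 // divr_gt0.
split; first by apply/rD/(in_ballE _ _ r0); nra.
have [w0|w0] := eqVneq (nrm (w - z)) 0.
  by move/eqP: w0; rewrite nrm_eq0 subr_eq0 => /eqP ->; lra.
have {}w0 : 0 < nrm (w - z) by rewrite lt_def w0 nrm_ge0.
pose t := nrm (w - z) / (r / 2).
have r20 : 0 < r / 2 by lra.
have tt : 0 < t by rewrite divr_gt0.
have tt0 : t < t0 by rewrite ltr_pdivrMr.
pose v := z + t^-1 *: (w - z).
have vz : nrm (v - z) = r / 2.
  rewrite /v addrC addKr nrmZ gtr0_norm ?invr_gt0 // /t invf_div divfK //.
  by rewrite gt_eqF.
have wE : w = (1 - t) *: z + t *: v.
  by rewrite /v; apply/colP => i; rewrite !mxE; field; lra.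
have zin : in_ball z r z by apply/(in_ballE _ _ r0); rewrite subrr nrm0.
have vin : in_ball z r v by apply/(in_ballE _ _ r0); rewrite vz; lra.
have := semiconcave_conv rsc zin vin (t := t).
have -> : 0 <= t <= 1 = true by apply/andP; split; lra.
move=> /(_ isT); rewrite -wE -(opprB v) sqnormN -sqr_nrm vz => hw.
have hv := hM v (rD v vin).
have k1 : t * (1 - t) <= t by nra.
have k2 : 0 <= ka * r ^+ 2 by rewrite mulr_ge0 ?sqr_ge0.
have k3 := ler_wpM2r k2 k1.
have k4 : t * Q < e by apply: lt_le_trans t0Q; rewrite ltr_pM2r.
rewrite /Q in k4; have := ler_wpM2l (ltW tt) hv; nra.
Qed.

Lemma qform_bounded n (A : 'M[R]_n) :
  exists2 C : R, 0 <= C & forall v, `|qform A v| <= C * sqnorm v.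
Proof.
have [C C0 CP] := mulmx_bounded A; exists C => // v.
rewrite qformE; apply: le_trans (normr_dotv _ _) _.
by rewrite -sqr_nrm expr2 mulrCA ler_wpM2l ?nrm_ge0.
Qed.

Lemma qform_mid n (A : 'M[R]_n) u v : Defs.symmetric A ->
  2 * qform A (mid u v) = qform A u + qform A v - 2^-1 * qform A (u - v).
Proof.
move=> sA; rewrite /mid qformZ !qformD // qformN dotvNr; by field.
Qed.

Section FixedFunction.
Variables (n m : nat) (X : set 'cV[R]_n) (F : jetset R n) (f : 'cV[R]_(n + m) -> R).
Hypothesis fsub : F_subharmonic (prod_domain m X) (prodP m F) f.

Definition cur x y := f (col_mx x y).

Lemma block_contact x1 y1 d p q A B D : X x1 -> 0 < d ->
  Defs.symmetric A -> Defs.symmetric D ->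
  (forall x y, nrm (x - x1) < d -> nrm (y - y1) < d -> X x ->
    cur x y <= cur x1 y1 + dotv p (x - x1) + dotv q (y - y1)
      + 2^-1 * (qform A (x - x1) + 2 * dotv (x - x1) (B *m (y - y1)) + qform D (y - y1))) ->
  prodP m F (col_mx x1 y1) (cur x1 y1) (col_mx p q) (block_mx A B B^T D).
Proof.
move=> Xx1 d0 sA sD H; apply: fsub.2; first by rewrite /prod_domain /= col_mxKu.
split; first by rewrite /Defs.symmetric tr_block_mx sA sD trmxK.
exists d => // z Xz /(in_ballE _ _ d0).
move: Xz; rewrite -(vsubmxK z) /prod_domain /= col_mxKu.
set x := usubmx z; set y := dsubmx z => Xx.
rewrite opp_col_mx add_col_mx => zd.
have := H x y (le_lt_trans (nrm_col_mxl _ _) zd) (le_lt_trans (nrm_col_mxr _ _) zd) Xx.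
rewrite dotv_col_mx qform_block /cur.
have -> : dotv (y - y1) (B^T *m (x - x1)) = dotv (x - x1) (B *m (y - y1)).
  by rewrite dotvC dotv_trmx.
lra.
Qed.

(** Uses only the condition along the y-fibre, so the x-block of the test function may be any
    multiple of the identity. *)
Lemma psd_of_contact x1 y1 d p q k D : X x1 -> 0 < d -> Defs.symmetric D ->
  (forall x y, nrm (x - x1) < d -> nrm (y - y1) < d -> X x ->
    cur x y <= cur x1 y1 + dotv p (x - x1) + dotv q (y - y1)
      + 2^-1 * (k * sqnorm (x - x1) + qform D (y - y1))) ->
  psd D.
Proof.
move=> Xx1 d0 sD H.
have := @block_contact x1 y1 d p q k%:M 0 D Xx1 d0 (tr_scalar_mx _ _) sD.
case=> [x y hx hy Xx|_]; last by rewrite block_mxKdr.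
have := H x y hx hy Xx; rewrite mul0mx dotv0r qform_scal; lra.
Qed.

(** Pulling back along the same [G], the multiples 2 N, -4 N and 2 N of G^T G cancel and leave
    [A]. *)
Lemma hessian_of_mixed_contact x1 y1 A r p : hessian_only X F ->
  X x1 -> Defs.symmetric A -> mixed_contact cur x1 y1 A -> F x1 r p A.
Proof.
move=> hF Xx1 sA [d [N [p1 [q [G [d0 H]]]]]].
have [|||/(_ G) + _] := @block_contact x1 y1 d p1 q (A + (2 * N) *: (G^T *m G))
  (- ((2 * N) *: G^T)) (2 * N)%:M Xx1 d0.
- by rewrite /Defs.symmetric linearD /= linearZ /= trmx_mul trmxK sA.
- by rewrite /Defs.symmetric tr_scalar_mx.
- move=> x y hx hy _; apply: le_trans (H x y hx hy) _.
  set u := x - x1; set v := y - y1.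
  rewrite qformDl (qformE (_ *: _)) -scalemxAl dotvZr -mulmxA (dotvC u (G^T *m _)) dotv_trmx -sqnormE.
  rewrite qform_scal mulNmx dotvNr -scalemxAl dotvZr (dotvC u (G^T *m _)) dotv_trmx
    (sqnormB v); lra.
rewrite col_mxKu block_mxKul block_mxKur block_mxKdr.
have -> : A + (2 * N) *: (G^T *m G) + - ((2 * N) *: G^T) *m G
    + G^T *m (- ((2 * N) *: G^T))^T + G^T *m (2 * N)%:M *m G = A.
  have -> : (- ((2 * N) *: G^T))^T = - ((2 * N) *: G).
    by rewrite linearN linearZ /= trmxK.
  rewrite mulmxN -scalemxAr mulNmx -scalemxAl mul_mx_scalar -scalemxAl.
  by rewrite addrK subrK.
by move=> h; exact: (hF x1 _ r _ p A Xx1 sA).1 h.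
Qed.

Hypothesis fsc : locally_semiconcave (prod_domain m X) f.
Hypothesis fbd : bounded_below_on (prod_domain m X) f.

(** Upper semicontinuity is part of subharmonicity; lower semicontinuity comes from
    semiconcavity. *)
Lemma cur_cont x y (e : R) : X x -> 0 < e -> exists2 d : R, 0 < d &
  forall x' y', nrm (x' - x) < d -> nrm (y' - y) < d ->
    X x' /\ `|cur x' y' - cur x y| < e.
Proof.
move=> Xx e0; have Dz : prod_domain m X (col_mx x y) by rewrite /prod_domain /= col_mxKu.
have [d1 d10 h1] := semiconcave_lsc fsc fbd Dz e0.
have [d2 d20 h2] := fsub.1 _ Dz _ e0.
exists (Num.min d1 d2 / 2) => [|x' y' hx hy]; first by rewrite divr_gt0 // lt_min d10.
have nd : nrm (col_mx x' y' - col_mx x y) < Num.min d1 d2.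
  rewrite opp_col_mx add_col_mx; apply: le_lt_trans (nrm_col_mx _ _) _; lra.
move: nd; rewrite lt_min => /andP[n1 n2].
have [D' k1] := h1 _ n1.
have k2 := h2 _ D' ((in_ballE _ _ d20).2 n2).
split; first by move: D'; rewrite /prod_domain /= col_mxKu.
rewrite ltr_norml /cur; apply/andP; split; lra.
Qed.

(* A violation of convexity along the segment from [y1] to [y2] yields a
   contact point inside a thin tube around it, with a strictly concave test
   function in the direction [y2 - y1]. *)
Lemma cur_convex x y1 y2 t : X x -> 0 <= t <= 1 ->
  cur x ((1 - t) *: y1 + t *: y2) <= (1 - t) * cur x y1 + t * cur x y2.
Proof.
move=> Xx /andP[t0 t1]; rewrite leNgt; apply/negP => viol.
pose e := y2 - y1; pose E := sqnorm e.
have E0 : 0 < E.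
  rewrite lt_def sqnorm_ge0 andbT sqnorm_eq0 subr_eq0; apply/eqP => y12.
  move: viol; rewrite y12; have -> : (1 - t) *: y1 + t *: y1 = y1.
    by rewrite -scalerDl subrK scale1r.
  lra.
set f1 := cur x y1 in viol; set f2 := cur x y2 in viol.
set yt := (1 - t) *: y1 + t *: y2 in viol.
pose ga := cur x yt - ((1 - t) * f1 + t * f2).
have ga0 : 0 < ga by rewrite /ga; lra.
have ga2 : 0 < ga / 2 by lra.
(* [sig] is the coordinate along the segment, 0 at [y1] and 1 at [y2]; [perp] is the squared
   distance to its line in the product space. *)
pose sig (z : 'cV[R]_(n + m)) := E^-1 * dotv e (dsubmx z - y1).
pose perp (z : 'cV[R]_(n + m)) := sqnorm (usubmx z - x) + sqnorm (dsubmx z - y1)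
  - E * (sig z * sig z).
have vX : vcont (fun z : 'cV[R]_(n + m) => usubmx z - x).
  by apply: vcontB; [exact: vcont_usub|exact: vcont_cst].
have vY : vcont (fun z : 'cV[R]_(n + m) => dsubmx z - y1).
  by apply: vcontB; [exact: vcont_dsub|exact: vcont_cst].
have csig : cont sig by apply: cont_scale; apply: cont_dotv => //; exact: vcont_cst.
have cperp : cont perp.
  apply: contB; first by apply: contD; exact: cont_sqnorm.
  by apply: cont_scale; exact: contM.
have perp_x z : sqnorm (usubmx z - x) <= perp z.
  rewrite /perp -addrA lerDl subr_ge0 /sig.
  have -> : E * (E^-1 * dotv e (dsubmx z - y1) * (E^-1 * dotv e (dsubmx z - y1))) =
     dotv e (dsubmx z - y1) ^+ 2 / E by field; lra.
  by rewrite ler_pdivrMr // mulrC; exact: CauchySchwarz.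
have [d1 d10 h1] := cur_cont y1 Xx ga2.
have [d2 d20 h2] := cur_cont y2 Xx ga2.
pose rho := Num.min d1 d2 / 2.
have rho0 : 0 < rho by rewrite divr_gt0 // lt_min d10.
have rd1 : rho < d1.
  by have : Num.min d1 d2 <= d1 by [rewrite ge_min lexx]; rewrite /rho; lra.
have rd2 : rho < d2.
  by have : Num.min d1 d2 <= d2 by [rewrite ge_min lexx orbT]; rewrite /rho; lra.
pose C := [set z | - sig z <= 0] `&` ([set z | sig z <= 1] `&`
  [set z | perp z <= rho ^+ 2]).
have perp_nrm z : perp z <= rho ^+ 2 -> nrm (usubmx z - x) <= rho.
  by move=> hz; rewrite le_nrm ?(ltW rho0) //; exact: le_trans (perp_x z) hz.
have CX z : C z -> X (usubmx z).
  move=> [_ [_ /perp_nrm hz]].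
  by have [||//] := h1 (usubmx z) y1; [lra|rewrite subrr nrm0].
have CC : closed_pts C.
  apply: closedI; last by apply: closedI; exact: closed_le.
  by apply: closed_le => v r r0; have [d d0 h] := csig v r r0; exists d => // w /h;
    rewrite -opprD normrN.
have Cb z : C z -> nrm z <= nrm x + rho + (nrm y1 + (rho + E + 1)).
  move=> [/= s0 [/= s1 hz]]; rewrite -(vsubmxK z).
  apply: le_trans (nrm_col_mx _ _) _; apply: lerD.
    by have := nrmD (usubmx z - x) x; rewrite subrK; have := perp_nrm z hz; lra.
  have : nrm (dsubmx z - y1) <= rho + E + 1.
    rewrite le_nrm; last lra.
    have : sqnorm (dsubmx z - y1) <= rho ^+ 2 + E * (sig z * sig z).
      by move: hz; rewrite /perp; have := sqnorm_ge0 (usubmx z - x); lra.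
    have : E * (sig z * sig z) <= E by rewrite ler_piMr ?(ltW E0) //; nra.
    nra.
  by have := nrmD (dsubmx z - y1) y1; rewrite subrK; lra.
pose zt := col_mx x yt.
have sigt : sig zt = t.
  rewrite /sig /zt col_mxKd.
  have -> : yt - y1 = t *: e by apply/colP => i; rewrite !mxE; ring.
  by rewrite dotvZr -sqnormE -/E mulrCA mulVf ?mulr1 // gt_eqF.
have perpt : perp zt = 0.
  rewrite /perp sigt /zt col_mxKu col_mxKd subrr sqnorm0.
  have -> : yt - y1 = t *: e by apply/colP => i; rewrite !mxE; ring.
  by rewrite sqnormZ -/E; ring.
have Cne : C !=set0.
  by exists zt; rewrite /C /= sigt perpt oppr_le0 sqr_ge0.
have fusc z : C z -> usc_at C f z.
  move=> Cz r r0; have [d d0 hd] := fsub.1 _ (CX z Cz) r r0.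
  exists d => // w Cw wz; apply: hd; first exact: CX.
  exact/(in_ballE _ _ d0).
have [zM _ fM] := usc_max Cne Cb CC fusc.
(* Large enough to exclude the lateral boundary of the tube, where perp = rho^2. *)
pose N := (`|f zM| + `|f1| + `|f2|) / rho ^+ 2.
have rho2 : 0 < rho ^+ 2 by rewrite exprn_gt0.
have N0 : 0 <= N by rewrite divr_ge0 ?(ltW rho2) // !addr_ge0.
(* Interpolation of the end values, a concave bump of height ga / 8, and confinement to the tube.
   The excess over [phi] beats ga / 2 at [zt] and stays below it on the end caps. *)
pose phi z := f1 + (f2 - f1) * sig z + ga / 2 * (sig z * (1 - sig z)) + N * perp z.
have cphi : cont phi.
  apply: contD; last exact: cont_scale.
  apply: contD; first by apply: contD; [exact: cont_cst|exact: cont_scale].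
  by apply: cont_scale; apply: contM => //; apply: contB => //; exact: cont_cst.
have [z1 Cz1 z1max] : exists2 z, C z & forall w, C w -> f w - phi w <= f z - phi z.
  apply: usc_max Cne Cb CC _ => z Cz; apply: usc_atD; first exact: fusc.
  move=> v r r0; have [d d0 h] := cphi v r r0; exists d => // w /h.
  by rewrite -opprD normrN.
have big : ga / 2 < f z1 - phi z1.
  have Czt : C zt by rewrite /C /= sigt perpt oppr_le0 sqr_ge0.
  apply: lt_le_trans (z1max zt Czt).
  rewrite /phi sigt perpt -/(cur x yt).
  have -> : cur x yt = ga + ((1 - t) * f1 + t * f2) by rewrite /ga subrK.
  have : t * (1 - t) <= 4^-1 by have := sqr_ge0 (t - 2^-1); nra.
  move=> /(ler_wpM2l (ltW ga2)); lra.
have [/= s0 [/= s1 hp]] := Cz1.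
have s01 : 0 <= sig z1 by lra.
have perp0 : 0 <= perp z1 by exact: le_trans (sqnorm_ge0 _) (perp_x z1).
have sp : 0 <= ga / 2 * (sig z1 * (1 - sig z1)).
  by rewrite mulr_ge0 ?(ltW ga2) // mulr_ge0 // subr_ge0.
have Np : 0 <= N * perp z1 by rewrite mulr_ge0.
have z1E : f z1 = cur (usubmx z1) (dsubmx z1) by rewrite /cur vsubmxK.
have yside : sqnorm (dsubmx z1 - y1) <= rho ^+ 2 + E * (sig z1 * sig z1).
  by move: hp; rewrite /perp; have := sqnorm_ge0 (usubmx z1 - x); lra.
have ss0 : 0 < sig z1.
  rewrite lt_def s01 andbT; apply/eqP => sz.
  have [||_] := h1 (usubmx z1) (dsubmx z1).
  - by apply: le_lt_trans rd1; exact: perp_nrm.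
  - apply: le_lt_trans rd1; rewrite le_nrm ?(ltW rho0) //.
    by move: yside; rewrite sz mulr0 mulr0 addr0.
  rewrite ltr_norml -z1E -/f1 => /andP[_ k].
  by move: big; rewrite /phi sz; lra.
have ss1 : sig z1 < 1.
  rewrite lt_def s1 andbT; apply/eqP => sz.
  have [||_] := h2 (usubmx z1) (dsubmx z1).
  - by apply: le_lt_trans rd2; exact: perp_nrm.
  - apply: le_lt_trans rd2; rewrite le_nrm ?(ltW rho0) //.
    have -> : dsubmx z1 - y2 = (dsubmx z1 - y1) - e by rewrite /e opprB addrA subrK.
    rewrite sqnormB -/E (dotvC _ e).
    have : dotv e (dsubmx z1 - y1) = E.
      by rewrite -[RHS]mulr1 sz /sig mulVKf // gt_eqF.
    move: yside; rewrite -sz => h; lra.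
  rewrite ltr_norml -z1E -/f2 => /andP[_ k].
  by move: big; rewrite /phi -sz; lra.
have pp : perp z1 < rho ^+ 2.
  rewrite lt_def hp andbT; apply/eqP => pz.
  have := fM z1 Cz1; move: big; rewrite /phi -pz.
  have -> : N * rho ^+ 2 = `|f zM| + `|f1| + `|f2| by rewrite /N divfK // gt_eqF.
  have := ler_norm (f zM); have := ler_norm (- f1); have := ler_norm (- f2).
  rewrite !normrN; have := normr_ge0 f1; have := normr_ge0 f2.
  have : - (`|f1| + `|f2|) <= f1 + (f2 - f1) * sig z1.
    have := ler_norm (- f1); have := ler_norm (- f2); rewrite !normrN.
    have := normr_ge0 f1; have := normr_ge0 f2; nra.
  lra.
pose mn := Num.min (sig z1) (Num.min (1 - sig z1) (rho ^+ 2 - perp z1)).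
have mn0 : 0 < mn by rewrite /mn !lt_min ss0 !subr_gt0 ss1.
have [d3 d30 h3] := csig z1 mn mn0.
have [d4 d40 h4] := cperp z1 mn mn0.
pose xm := usubmx z1; pose ym := dsubmx z1.
pose D := (2 * N)%:M - (2 * (ga / 2 + N * E) / E ^+ 2) *: (e *m e^T).
have sD : Defs.symmetric D.
  by rewrite /Defs.symmetric linearB /= tr_scalar_mx linearZ /= trmx_mul trmxK.
have mn1 : mn <= sig z1 by rewrite /mn ge_min lexx.
have mn2 : mn <= 1 - sig z1 by rewrite /mn !ge_min lexx orbT.
have mn3 : mn <= rho ^+ 2 - perp z1 by rewrite /mn !ge_min lexx !orbT.
have qD v : qform D v =
    2 * N * sqnorm v - 2 * (ga / 2 + N * E) * (E^-1 * dotv e v) ^+ 2.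
  rewrite qformDl qformNl qform_scal (qformE (_ *: _)) -scalemxAl dotvZr -qformE.
  by rewrite qform_dyad; field; lra.
have pD : psd D.
  apply: (@psd_of_contact xm ym (Num.min d3 d4 / 2) ((2 * N) *: (xm - x))
    (((f2 - f1 + ga / 2 * (1 - 2 * sig z1) - 2 * N * E * sig z1) / E) *: e
      + (2 * N) *: (ym - y1)) (2 * N) D (CX z1 Cz1)) => //.
    by rewrite divr_gt0 // lt_min d30.
  move=> x' y' hx hy Xx'.
  have nd : nrm (col_mx x' y' - z1) < Num.min d3 d4.
    rewrite -(vsubmxK z1) opp_col_mx add_col_mx.
    apply: le_lt_trans (nrm_col_mx _ _) _; rewrite -/xm -/ym; lra.
  move: nd; rewrite lt_min => /andP[/h3 k3 /h4 k4].
  move: k3 k4; rewrite !ltr_norml => /andP[k3 k3'] /andP[k4 k4'].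
  have Cz : C (col_mx x' y') by split; [|split] => /=; lra.
  have := z1max _ Cz; rewrite {1}z1E -/xm -/ym /phi -[f _]/(cur x' y').
  pose tau := E^-1 * dotv e (y' - ym).
  have sigE : sig (col_mx x' y') = sig z1 + tau.
    rewrite /sig /tau col_mxKd -/ym -mulrDr -dotvDr; congr (_ * dotv _ _).
    by rewrite [RHS]addrC subrKA.
  have perpE : perp (col_mx x' y') = perp z1 + 2 * dotv (xm - x) (x' - xm)
     + sqnorm (x' - xm) + 2 * dotv (ym - y1) (y' - ym) + sqnorm (y' - ym)
     - E * (2 * sig z1 * tau + tau ^+ 2).
    rewrite /perp sigE col_mxKu col_mxKd -/xm -/ym.
    have -> : x' - x = (xm - x) + (x' - xm) by rewrite [RHS]addrC subrKA.
    have -> : y' - y1 = (ym - y1) + (y' - ym) by rewrite [RHS]addrC subrKA.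
    rewrite (sqnormD (xm - x)) (sqnormD (ym - y1)); ring.
  rewrite sigE perpE qD -/tau dotvZl (dotvDl (y' - ym) (_ *: e)) !dotvZl.
  have -> : (f2 - f1 + ga / 2 * (1 - 2 * sig z1) - 2 * N * E * sig z1) / E
      * dotv e (y' - ym) =
     (f2 - f1 + ga / 2 * (1 - 2 * sig z1) - 2 * N * E * sig z1) * tau.
    by rewrite /tau; ring.
  lra.
(* The confinement cancels along [e], leaving the bump: the form takes the value -ga. *)
have := pD.2 e; rewrite qD -sqnormE -/E mulVf ?gt_eqF //; lra.
Qed.

(** * Strongly convex regularisation in [y] *)

Definition reg (eps : R) x y := cur x y + eps * sqnorm y.

Lemma reg_cont eps x y (e : R) : X x -> 0 < e -> exists2 d : R, 0 < d &
  forall x' y', nrm (x' - x) < d -> nrm (y' - y) < d ->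
    X x' /\ `|reg eps x' y' - reg eps x y| < e.
Proof.
move=> Xx e0; have e2 : 0 < e / 2 by rewrite divr_gt0.
have [d d0 h] := cur_cont y Xx e2.
have [d' d'0 h'] := cont_scale eps (cont_sqnorm (@vcont_id R m)) y e2.
exists (Num.min d d') => [|x' y']; first by rewrite lt_min d0.
rewrite !lt_min => /andP[x1 _] /andP[y1 /h' k']; have [Xx' k] := h _ _ x1 y1.
split=> //; rewrite /reg opprD addrACA; apply: le_lt_trans (ler_normD _ _) _.
lra.
Qed.

Lemma reg_min_exists (eps : R) x : 0 < eps -> X x ->
  exists y, forall y', reg eps x y <= reg eps x y'.
Proof.
move=> eps0 Xx; have [M hM] := fbd.
have cM y : M <= cur x y by apply: hM; rewrite /prod_domain /= col_mxKu.
(* Beyond squared radius [Q], [eps * sqnorm y] and the lower bound [M] already bring [reg] above its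
   value at y = 0. *)
pose Q := (reg eps x 0 - M) / eps.
have Q0 : 0 <= Q.
  by rewrite divr_ge0 ?(ltW eps0) // /reg sqnorm0 mulr0 addr0 subr_ge0.
have out y : Num.sqrt Q < nrm y -> reg eps x 0 <= reg eps x y.
  rewrite -ltr_sqr ?nnegrE ?sqrtr_ge0 // sqr_sqrtr // sqr_nrm ltr_pdivrMr //.
  by have := cM y; rewrite [reg eps x y]/reg; lra.
have [||||y yQ ymax] := @usc_max R m [set y | nrm y <= Num.sqrt Q]
    (fun y => - reg eps x y) (Num.sqrt Q).
- by exists 0; rewrite /= nrm0 sqrtr_ge0.
- by [].
- by apply: closed_nrm_le; [exact: sqrtr_ge0|exact: vcont_id].
- move=> y _ e e0; have [d d0 h] := reg_cont eps y Xx e0.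
  exists d => // y' _ yy; have := h x y'; rewrite subrr nrm0 => /(_ d0 yy)[_].
  by rewrite ltr_norml => /andP[]; lra.
exists y => y'; have [hy'|/out hy'] := leP (nrm y') (Num.sqrt Q).
  by have := ymax y' hy'; rewrite lerN2.
apply: le_trans hy'; have := ymax 0; rewrite /= nrm0 lerN2; apply.
exact: sqrtr_ge0.
Qed.

Lemma reg_conv (eps : R) x y1 y2 t : X x -> 0 <= t <= 1 ->
  reg eps x ((1 - t) *: y1 + t *: y2) <= (1 - t) * reg eps x y1 + t * reg eps x y2
    - eps * (t * (1 - t)) * sqnorm (y1 - y2).
Proof.
move=> Xx t01; have := cur_convex y1 y2 Xx t01.
rewrite /reg sqnorm_conv; lra.
Qed.

Hypothesis Fpos : positivity X F.
Hypothesis Fcst : constant_coefficient X F.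
Hypothesis Fhess : hessian_only X F.

Lemma reg_contact (eps : R) xs ys (d : R) p A (s : R) : 0 < eps -> X xs ->
  (forall y, reg eps xs ys <= reg eps xs y) -> 0 < d -> Defs.symmetric A ->
  (forall x, nrm (x - xs) <= d -> X x /\ exists2 y,
    (forall y', reg eps x y <= reg eps x y') &
    reg eps x y <= reg eps xs ys + dotv p (x - xs) + 2^-1 * qform A (x - xs)) ->
  0 < s -> F xs 0 0 (A + s%:M).
Proof.
move=> eps0 Xs ysmin d0 sA H s0.
pose Q u := dotv p u + 2^-1 * qform A u.
have cQ : cont Q.
  apply: contD; first by apply: cont_dotv; [exact: vcont_cst|exact: vcont_id].
  by apply: cont_scale; apply: cont_qform; exact: vcont_id.
pose f2 u v := reg eps (xs + u) (ys + v) - reg eps xs ys - Q u.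
have Xu u : nrm u <= d -> X (xs + u).
  by move=> ud; have [] := H (xs + u); rewrite // addrC addKr.
have Q0 : Q 0 = 0 by rewrite /Q dotv0r qform0 mulr0 addr0.
have f200 : f2 0 0 = 0 by rewrite /f2 !addr0 Q0 subrr subr0.
have f20 v : 0 <= f2 0 v by rewrite /f2 addr0 Q0 subr0 subr_ge0.
have f2conv u v1 v2 (t : R) : nrm u <= d -> 0 <= t <= 1 ->
    f2 u ((1 - t) *: v1 + t *: v2) <= (1 - t) * f2 u v1 + t * f2 u v2
      - eps * (t * (1 - t)) * sqnorm (v1 - v2).
  move=> ud t01; have := reg_conv eps (ys + v1) (ys + v2) (Xu u ud) t01.
  have -> : (1 - t) *: (ys + v1) + t *: (ys + v2) =
      ys + ((1 - t) *: v1 + t *: v2).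
    by apply/colP => i; rewrite !mxE; ring.
  have -> : ys + v1 - (ys + v2) = v1 - v2 by rewrite opprD addrACA subrr add0r.
  by rewrite /f2; lra.
have f2cont u v (e : R) : nrm u <= d -> 0 < e -> exists2 dd : R, 0 < dd &
    forall u' v', nrm (u' - u) < dd -> nrm (v' - v) < dd ->
      `|f2 u' v' - f2 u v| < e.
  move=> ud e0; have e2 : 0 < e / 2 by rewrite divr_gt0.
  have [d1 d10 h1] := reg_cont eps (ys + v) (Xu u ud) e2.
  have [d2 d20 h2] := cQ u _ e2.
  exists (Num.min d1 d2) => [|u' v']; first by rewrite lt_min d10.
  rewrite !lt_min => /andP[u1 /h2 k2] /andP[v1 _].
  have [||_ k1] := h1 (xs + u') (ys + v').
  - by rewrite opprD addrACA subrr add0r.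
  - by rewrite opprD addrACA subrr add0r.
  have -> : f2 u' v' - f2 u v = (reg eps (xs + u') (ys + v') -
     reg eps (xs + u) (ys + v)) - (Q u' - Q u) by rewrite /f2; ring.
  by apply: le_lt_trans (ler_normB _ _) _; lra.
have Dz : prod_domain m X (col_mx xs ys) by rewrite /prod_domain /= col_mxKu.
have [r [ka [r0 ka0 rD rsc]]] := fsc Dz.
have n0d : nrm (0 : 'cV[R]_n) <= d by rewrite nrm0 ltW.
have [d1 d10 h1] := f2cont 0 0 1 n0d ltr01.
pose b := Num.min (r / 4) (d1 / 2).
have b0 : 0 < b by rewrite /b lt_min !divr_gt0.
have br : b <= r / 4 by rewrite /b ge_min lexx.
have bd1 : b <= d1 / 2 by rewrite /b ge_min lexx orbT.
(* At u = 0 strong convexity gives a definite rise on the sphere of radius [b]; compactness extends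
   it to small u. *)
have [a1 a10 a1P] : exists2 a1 : R, 0 < a1 & forall u v, nrm u <= a1 ->
    nrm v = b -> f2 u 0 < f2 u v.
  apply: contrapT => na.
  have /choice[uv uvP] j : exists w : 'cV[R]_n * 'cV[R]_m,
      [/\ nrm w.1 <= j.+1%:R^-1, nrm w.2 = b & f2 w.1 w.2 <= f2 w.1 0].
    apply: contrapT => nw; apply: na; exists j.+1%:R^-1; first by rewrite invr_gt0.
    move=> u v ua vb; rewrite ltNge; apply/negP => k; apply: nw.
    by exists (u, v).
  have uvb j : nrm (uv j).2 <= b by have [_ -> _] := uvP j.
  have [v cv] := ball_cluster uvb.
  have vb : b <= nrm v.
    apply/ler_addgt0Pr => e e0; have [j _ je] := cv e e0 0%N.
    have [_ hb _] := uvP j; rewrite -hb.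
    by have := nrmD ((uv j).2 - v) v; rewrite subrK; lra.
  have pos : 0 < eps * sqnorm v.
    by rewrite mulr_gt0 // -sqr_nrm exprn_gt0 //; lra.
  have f2v : eps / 2 * sqnorm v <= f2 0 v.
    have := f2conv 0 v 0 _ n0d (half01 R); rewrite f200 subr0.
    have := f20 ((1 - 2^-1) *: v + 2^-1 *: 0); lra.
  have e8 : 0 < eps / 8 * sqnorm v by lra.
  have [d2 d20 h2] := f2cont 0 v _ n0d e8.
  have [d3 d30 h3] := f2cont 0 0 _ n0d e8.
  have dm : 0 < Num.min d2 d3 by rewrite lt_min d20.
  have [N NP] := nat_inv_lt dm.
  have [j Nj jv] := cv d2 d20 N; have [ju _ jf] := uvP j.
  have := le_lt_trans ju (NP j Nj); rewrite lt_min => /andP[j2 j3].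
  have := h2 (uv j).1 (uv j).2; rewrite subr0 => /(_ j2 jv).
  have := h3 (uv j).1 0; rewrite !subr0 nrm0 => /(_ j3 d30).
  by rewrite f200 !ltr_norml => /andP[k1 k2] /andP[k3 k4]; lra.
pose a := Num.min (Num.min d a1) b.
have a0 : 0 < a by rewrite /a lt_min lt_min d0 a10 b0.
have ad : a <= d by rewrite /a ge_min ge_min lexx.
have aa1 : a <= a1 by rewrite /a ge_min ge_min lexx orbT.
have ab : a <= b by rewrite /a ge_min lexx orbT.
have [Cq Cq0 CqP] := qform_bounded A.
have inU u v : nrm u <= a -> nrm v <= b ->
    in_ball (col_mx xs ys) r (col_mx (xs + u) (ys + v)).
  move=> ua vb; apply/(in_ballE _ _ r0).
  rewrite opp_col_mx add_col_mx ![_ + _ - _]addrAC !subrr !add0r.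
  by apply: le_lt_trans (nrm_col_mx _ _) _; lra.
(* The constant collects midpoint defects: ka / 4 from [f], eps / 2 from the regularisation, Cq / 4
   from the paraboloid, and 1 for positivity. *)
have sd : saddle f2 a b (ka / 4 + eps / 2 + Cq / 4 + 1) eps 1.
  split=> //; first lra.
  - move=> u v ua vb e e0; have [dd dd0 h] := f2cont u v e (le_trans ua ad) e0.
    by exists dd => // u' v' _ _; exact: h.
  - move=> u1 u2 v1 v2 ua1 ua2 vb1 vb2.
    have := semiconcave_conv rsc (inU _ _ ua1 vb1) (inU _ _ ua2 vb2) (half01 R).
    rewrite -midE.
    have -> : mid (col_mx (xs + u1) (ys + v1)) (col_mx (xs + u2) (ys + v2)) =
        col_mx (xs + mid u1 u2) (ys + mid v1 v2).
      rewrite /mid add_col_mx scale_col_mx.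
      by congr col_mx; apply/colP => i; rewrite !mxE; field.
    rewrite opp_col_mx add_col_mx sqnorm_col_mx.
    have -> : xs + u1 - (xs + u2) = u1 - u2 by rewrite opprD addrACA subrr add0r.
    have -> : ys + v1 - (ys + v2) = v1 - v2 by rewrite opprD addrACA subrr add0r.
    have := sqnorm_mid (ys + v1) (ys + v2).
    have -> : mid (ys + v1) (ys + v2) = ys + mid v1 v2.
      by apply/colP => i; rewrite !mxE; field.
    have -> : ys + v1 - (ys + v2) = v1 - v2 by rewrite opprD addrACA subrr add0r.
    have := qform_mid u1 u2 sA; have := CqP (u1 - u2); rewrite ler_norml.
    have -> : f2 u1 v1 = cur (xs + u1) (ys + v1) + eps * sqnorm (ys + v1)
      - reg eps xs ys - (dotv p u1 + 2^-1 * qform A u1) by [].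
    have -> : f2 u2 v2 = cur (xs + u2) (ys + v2) + eps * sqnorm (ys + v2)
      - reg eps xs ys - (dotv p u2 + 2^-1 * qform A u2) by [].
    have -> : f2 (mid u1 u2) (mid v1 v2) = cur (xs + mid u1 u2) (ys + mid v1 v2)
      + eps * sqnorm (ys + mid v1 v2) - reg eps xs ys
      - (2^-1 * (dotv p u1 + dotv p u2) + 2^-1 * qform A (mid u1 u2)).
      by rewrite /f2 /Q {2}/mid dotvZr dotvDr.
    rewrite /cur => /andP[k1 k2] k3 k4 k5.
    have k6 : eps * (2 * sqnorm (ys + mid v1 v2)) = eps * (sqnorm (ys + v1)
        + sqnorm (ys + v2) - 2^-1 * sqnorm (v1 - v2)) by rewrite k4.
    have Du := sqnorm_ge0 (u1 - u2); have Dv := sqnorm_ge0 (v1 - v2).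
    have m1 := mulr_ge0 ka0 Du; have m2 := mulr_ge0 ka0 Dv.
    have m3 := mulr_ge0 (ltW eps0) Du; have m4 := mulr_ge0 (ltW eps0) Dv.
    have m5 := mulr_ge0 Cq0 Du; have m6 := mulr_ge0 Cq0 Dv.
    lra.
  - by move=> u v1 v2 t ua _ _ t01; exact: f2conv (le_trans ua ad) t01.
  - move=> u v ua vb; have := h1 u v; rewrite !subr0 f200 subr0 => k.
    by apply/ltW/k; lra.
  - move=> u ua e e0; have ud := le_trans ua ad.
    have [_ [y ymin yle]] : X (xs + u) /\ exists2 y,
      (forall y', reg eps (xs + u) y <= reg eps (xs + u) y') &
      reg eps (xs + u) y <= reg eps xs ys + dotv p u + 2^-1 * qform A u.
      by have := H (xs + u); rewrite addrC addKr; apply.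
    have yE : ys + (y - ys) = y by rewrite addrC subrK.
    have fy : f2 u (y - ys) <= 0 by rewrite /f2 /Q yE; lra.
    exists (y - ys); last exact: le_trans fy (ltW e0).
    rewrite leNgt; apply/negP => yb.
    set w := y - ys in yE fy yb; have w0 : 0 < nrm w by lra.
    (* For a minimiser outside the ball, convexity on the segment from 0 would make the value on the
       sphere at most that at 0, against [a1P]. *)
    pose t := b / nrm w.
    have t01 : 0 <= t <= 1.
      apply/andP; split; first by rewrite /t divr_ge0 ?nrm_ge0 ?(ltW b0).
      by rewrite /t ler_pdivrMr // mul1r ltW.
    have tb : nrm (t *: w) = b.
      by case/andP: t01 => t0 _; rewrite nrmZ ger0_norm // /t divfK // gt_eqF.
    have := a1P u (t *: w) (le_trans ua aa1) tb.
    have := f2conv u 0 w t ud t01; rewrite scaler0 add0r.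
    have f0w : f2 u w <= f2 u 0.
      by rewrite /f2 yE addr0 !lerD2r.
    have := sqnorm_ge0 (0 - w); case/andP: t01 => t0 t1.
    move=> k; have := mulr_ge0 (mulr_ge0 (ltW eps0) (mulr_ge0 t0 (_ : 0 <= 1 - t))) k.
    by rewrite subr_ge0 => /(_ t1); nra.
have [u1 [v1 [A' [u1a v1b sA' A's [dd [N [p' [q' [G [dd0 K]]]]]]]]]] :=
  saddle_mixed_contact sd s0.
have Xu1 : X (xs + u1) by apply: Xu; lra.
have sAA : Defs.symmetric (A' + A) by rewrite /Defs.symmetric linearD /= sA sA'.
have : F (xs + u1) 0 0 (A' + A).
  apply: (@hessian_of_mixed_contact (xs + u1) (ys + v1)) => //.
  exists dd, N, (p' + p + A *m u1), (q' - (2 * eps) *: (ys + v1)), G; split=> // x y.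
  have -> : x - (xs + u1) = (x - xs) - u1 by rewrite opprD addrA.
  have -> : y - (ys + v1) = (y - ys) - v1 by rewrite opprD addrA.
  move=> hx hy; have := K (x - xs) (y - ys) hx hy; rewrite /f2 /reg.
  have -> : xs + (x - xs) = x by rewrite addrC subrK.
  have -> : ys + (y - ys) = y by rewrite addrC subrK.
  have [du duE] : exists du, x - xs = u1 + du.
    by exists (x - xs - u1); rewrite [RHS]addrC subrK.
  have [dv dvE] : exists dv, y - ys = v1 + dv.
    by exists (y - ys - v1); rewrite [RHS]addrC subrK.
  have yE : y = ys + v1 + dv by rewrite -addrA -dvE [RHS]addrC subrK.
  rewrite duE dvE [u1 + du]addrC [v1 + dv]addrC !addrK /Q.
  have -> : sqnorm y = sqnorm (ys + v1 + dv) by rewrite -yE.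
  rewrite (sqnormD (ys + v1)) (addrC du) !qformD // qformDl.
  rewrite (dotvDr p) !(dotvDl du) (dotvDl dv q') (dotvNl dv) (dotvZl dv).
  (* Undoing the regularisation leaves -eps |dv|^2, dropped from an upper bound. *)
  have := mulr_ge0 (ltW eps0) (sqnorm_ge0 dv); lra.
have sAs : Defs.symmetric (A + s%:M).
  by rewrite /Defs.symmetric linearD /= sA tr_scalar_mx.
move=> FA; apply: (proj2 (@Fcst xs (xs + u1) 0 0 (A + s%:M) Xs Xu1 sAs)).
(* Positivity absorbs s - A', psd because A' <= s. *)
have -> : A + s%:M = A' + A + (s%:M - A').
  by apply/matrixP => i j; rewrite !mxE; ring.
apply: Fpos => //; split.
  by rewrite /Defs.symmetric linearB /= sA' tr_scalar_mx.
by move=> v; rewrite qformDl qformNl qform_scal subr_ge0.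
Qed.

(** * From the regularised marginal to the marginal *)

Lemma marginal_le x y : X x -> marginal f x <= cur x y.
Proof.
move=> Xx; have [M hM] := fbd; apply: ge_inf; last by exists y.
by exists M => _ [y' _ <-]; apply: hM; rewrite /prod_domain /= col_mxKu.
Qed.

Lemma marginal_lt x r : X x -> marginal f x < r -> exists y, cur x y < r.
Proof.
move=> Xx gr; have [M hM] := fbd.
have hi : has_inf [set f (col_mx x y) | y in [set: 'cV[R]_m]].
  split; first by exists (f (col_mx x 0)); exists 0.
  by exists M => _ [y' _ <-]; apply: hM; rewrite /prod_domain /= col_mxKu.
have g0 : 0 < r - marginal f x by rewrite subr_gt0.
have [_ [y _ <-] hy] := inf_adherent g0 hi; exists y.
by move: hy; rewrite -/(marginal f x) addrC subrK.
Qed.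

Lemma marginal_usc : usc_on X (marginal f).
Proof.
move=> x Xx e e0; have e2 : 0 < e / 2 by rewrite divr_gt0.
have gx : marginal f x < marginal f x + e / 2 by rewrite ltrDl.
have [y hy] := marginal_lt Xx gx.
have [d d0 h] := cur_cont y Xx e2; exists d => // x' Xx' /(in_ballE _ _ d0) xd.
have := h x' y xd; rewrite subrr nrm0 => /(_ d0)[_]; rewrite ltr_norml => /andP[_ k].
by apply: le_lt_trans (marginal_le y Xx') _; lra.
Qed.

(** Otherwise points with no near minimiser in ever larger balls cluster at some z, and a near
    minimiser for z serves nearby points by continuity. The uniform radius lets [eps] be chosen
    before x is known. *)
Lemma near_minimisers_bounded x0 rho (q : 'cV[R]_n -> R) (eta : R) :
  (forall x, nrm (x - x0) <= rho -> X x /\ marginal f x <= q x) -> cont q ->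
  0 < eta -> exists2 r : R, 0 < r & forall x, nrm (x - x0) <= rho ->
    exists2 y, nrm y <= r & cur x y <= q x + eta.
Proof.
move=> H cq eta0; apply: contrapT => nr.
have /choice[xs xsP] j : exists x, nrm (x - x0) <= rho /\
    forall y, nrm y <= j.+1%:R -> q x + eta < cur x y.
  apply: contrapT => nx; apply: nr; exists j.+1%:R => // x xr.
  apply: contrapT => ny; apply: nx; exists x; split=> // y yr.
  by rewrite ltNge; apply/negP => hy; apply: ny; exists y.
have xsb j : nrm (xs j - x0) <= rho by case: (xsP j).
have [v cv] := ball_cluster xsb; pose z := x0 + v.
have zr : nrm (z - x0) <= rho.
  rewrite /z addrC addKr; apply/ler_addgt0Pr => e e0; have [j _ je] := cv e e0 0%N.
  have := nrmD (v - (xs j - x0)) (xs j - x0); rewrite subrK (nrmBC v).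
  by have := xsb j; lra.
have [Xz gz] := H z zr; have e3 : 0 < eta / 3 by rewrite divr_gt0.
have gz' : marginal f z < q z + eta / 3 by apply: le_lt_trans gz _; rewrite ltrDl.
have [y hy] := marginal_lt Xz gz'.
have [d1 d10 h1] := cur_cont y Xz e3; have [d2 d20 h2] := cq z _ e3.
have dm : 0 < Num.min d1 d2 by rewrite lt_min d10.
have [j jN] := cv _ dm (Num.bound (nrm y)).
have -> : xs j - x0 - v = xs j - z by rewrite /z opprD addrA.
rewrite lt_min => /andP[j1 j2].
have yd1 : nrm (y - y) < d1 by rewrite subrr nrm0.
have [_] := h1 (xs j) y j1 yd1; have := h2 _ j2; rewrite !ltr_norml => /andP[k1 _] /andP[_ k2].
have [_ /(_ y)] := xsP j.
have -> : nrm y <= j.+1%:R = true.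
  apply/idP/ltW; apply: lt_le_trans (archi_boundP (nrm_ge0 y)) _.
  by rewrite ler_nat ltnW.
by move=> /(_ isT); lra.
Qed.

Hypothesis oX : open_set X.

Lemma marginal_contact x0 p0 A0 (s : R) : X x0 ->
  upper_contact X (marginal f) x0 p0 A0 -> 0 < s -> F x0 0 0 (A0 + s%:M).
Proof.
move=> Xx0 [sA0 [d d0 hd]] s0; have [e e0 he] := oX Xx0.
pose rho := Num.min d e / 2.
have rho0 : 0 < rho by rewrite divr_gt0 // lt_min d0.
have rd : rho < d.
  by have : Num.min d e <= d by [rewrite ge_min lexx]; rewrite /rho; lra.
have re : rho < e.
  by have : Num.min d e <= e by [rewrite ge_min lexx orbT]; rewrite /rho; lra.
set g0 := marginal f x0.
pose q x := g0 + dotv p0 (x - x0) + 2^-1 * qform A0 (x - x0).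
have cx0 : vcont (fun x : 'cV[R]_n => x - x0).
  by apply: vcontB; [exact: vcont_id|exact: vcont_cst].
have cq : cont q.
  apply: contD; last by apply: cont_scale; exact: cont_qform.
  by apply: contD; [exact: cont_cst|apply: cont_dotv => //; exact: vcont_cst].
have H x : nrm (x - x0) <= rho -> X x /\ marginal f x <= q x.
  move=> xr; have Xx : X x by apply: he; apply/(in_ballE _ _ e0); lra.
  by split=> //; apply: hd => //; apply/(in_ballE _ _ d0); lra.
have r2 : 0 < rho ^+ 2 by rewrite exprn_gt0.
(* Adding s / 2 to the Hessian gains s rho^2 / 4 on the boundary sphere; near minimality and
   regularisation lose at most 2 eta = s rho^2 / 8. So the maximum is interior, and the other s / 2
   goes to [reg_contact]. *)
have eta0 : 0 < s * rho ^+ 2 / 16 by rewrite divr_gt0 // mulr_gt0.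
have [r r0 hr] := near_minimisers_bounded H cq eta0.
set eta := s * rho ^+ 2 / 16 in eta0 hr.
pose eps := eta / (r ^+ 2 + 1).
have rr : 0 < r ^+ 2 + 1 by rewrite ltr_wpDl ?sqr_ge0.
have eps0 : 0 < eps by rewrite divr_gt0.
have epsr : eps * r ^+ 2 <= eta.
  by rewrite /eps mulrAC ler_pdivrMr // ler_wpM2l ?(ltW eta0) // lerDl.
have /choice[ye yeP] x : exists y, X x -> forall y', reg eps x y <= reg eps x y'.
  have [Xx|nX] := pselect (X x); last by exists 0.
  by have [y hy] := reg_min_exists eps0 Xx; exists y.
pose A := A0 + (s / 2)%:M.
have sA : Defs.symmetric A by rewrite /Defs.symmetric linearD /= sA0 tr_scalar_mx.
pose q1 x := dotv p0 (x - x0) + 2^-1 * qform A (x - x0).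
have cq1 : cont q1.
  apply: contD; last by apply: cont_scale; exact: cont_qform.
  by apply: cont_dotv => //; exact: vcont_cst.
have qE x : q x = g0 + q1 x - s / 4 * sqnorm (x - x0).
  by rewrite /q /q1 qformDl qform_scal; field.
pose C := [set x | nrm (x - x0) <= rho].
have [||||xs Cxs xsmax] := @usc_max R n C (fun x => reg eps x (ye x) - q1 x) (nrm x0 + rho).
- by exists x0; rewrite /C /= subrr nrm0 ltW.
- move=> x; rewrite /C /= => hx; have := nrmD (x - x0) x0; rewrite subrK; lra.
- by apply: closed_nrm_le => //; exact: ltW.
- move=> x Cx; have [Xx _] := H x Cx; apply: usc_atD; last first.
    move=> v e1 e10; have [d1 d10 h1] := cont_scale (-1) cq1 v e10.
    by exists d1 => // w /h1; rewrite !mulN1r.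
  move=> e1 e10; have [d1 d10 h1] := reg_cont eps (ye x) Xx e10.
  exists d1 => // w Cw wx; have [Xw _] := H w Cw.
  apply: le_lt_trans (yeP w Xw (ye x)) _.
  have := h1 w (ye x) wx; rewrite subrr nrm0 => /(_ d10)[_].
  by rewrite ltr_norml => /andP[]; lra.
have Xxs := (H xs Cxs).1.
have at0 : g0 <= reg eps xs (ye xs) - q1 xs.
  apply: (le_trans _ (xsmax x0 _)); last by rewrite /C /= subrr nrm0 ltW.
  rewrite /q1 subrr dotv0r qform0 mulr0 addr0 subr0 /reg.
  have := marginal_le (ye x0) Xx0; rewrite -/g0.
  by have := mulr_ge0 (ltW eps0) (sqnorm_ge0 (ye x0)); lra.
have xsr : nrm (xs - x0) < rho.
  rewrite lt_def Cxs andbT; apply/eqP => xr.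
  have [y yr hy] := hr xs Cxs.
  have := yeP xs Xxs y; rewrite [reg eps xs y]/reg.
  have : eps * sqnorm y <= eps * r ^+ 2.
    by rewrite ler_wpM2l ?(ltW eps0) // -le_nrm // ltW.
  move: hy; rewrite qE -sqr_nrm -xr => hy k1 k2.
  have : eta = s * rho ^+ 2 / 16 by [].
  by move: r2 => /(mulr_gt0 s0); lra.
have AE : A0 + s%:M = A + (s / 2)%:M.
  by apply/matrixP => i j; rewrite !mxE -addrA -mulrnDl; congr (_ + _ *+ _); lra.
have sAs : Defs.symmetric (A0 + s%:M).
  by rewrite /Defs.symmetric linearD /= sA0 tr_scalar_mx.
apply: (proj2 (@Fcst x0 xs 0 0 _ Xx0 Xxs sAs)); rewrite AE.
apply: (reg_contact (d := rho - nrm (xs - x0)) (p := p0 + A *m (xs - x0)) eps0 Xxs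
  (yeP xs Xxs)) => //; last by rewrite divr_gt0.
  by rewrite subr_gt0.
move=> x xd; have Cx : C x.
  by rewrite /C /= -(subrKA xs); apply: le_trans (nrmD _ _) _; lra.
have Xx := (H x Cx).1; split=> //; exists (ye x); first exact: yeP.
have := xsmax x Cx; rewrite /q1.
have -> : x - x0 = (xs - x0) + (x - xs) by rewrite [RHS]addrC subrKA.
rewrite (dotvDr p0) qformD // dotvDl; lra.
Qed.

End FixedFunction.

End MarginalSubharmonic.

Theorem theorem1p2 (R : realType) (n m : nat) (X : set 'cV[R]_n)
    (F : jetset R n) (f : 'cV[R]_(n + m) -> R) :
  open_set X ->
  primitive_subequation X F ->
  constant_coefficient X F ->
  hessian_only X F ->
  locally_semiconcave (prod_domain m X) f ->
  bounded_below_on (prod_domain m X) f ->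
  F_subharmonic (prod_domain m X) (prodP m F) f ->
  F_subharmonic X F (marginal f).
Proof.
move=> oX [Fcl Fpos] Fcst Fhess fsc fbd fsub.
split; first exact: marginal_usc fsub fsc fbd.
move=> x p A Xx ctc; apply: contrapT => nF.
have sA := ctc.1.
(* The jet with Hessian A + e / 2 lies in the neighbourhood that closedness excludes, yet
   [marginal_contact] puts it in [F]. *)
have [e e0 H] := Fcl x _ p A Xx sA nF.
have e2 : 0 < e / 2 by rewrite divr_gt0.
have sAe : Defs.symmetric (A + (e / 2)%:M).
  by rewrite /Defs.symmetric linearD /= sA tr_scalar_mx.
apply: (H x (marginal f x) p (A + (e / 2)%:M) Xx sAe).
- by apply/(in_ballE _ _ e0); rewrite subrr nrm0.
- by rewrite subrr normr0.
- by apply/(in_ballE _ _ e0); rewrite subrr nrm0.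
- move=> i j; rewrite !mxE [_ - _]addrC addKr.
  case: (i == j); rewrite ?mulr1n ?mulr0n ?normr0 // gtr0_norm //; lra.
apply: (proj1 (Fhess x 0 (marginal f x) 0 p _ Xx sAe)).
exact: (marginal_contact fsub fsc fbd Fpos Fcst Fhess oX Xx ctc e2).
Qed.
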